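(* Let $\mathbb{K}$ be an algebraically closed field of characteristic $0$, $S=\mathbb{K}[x_1,\ldots,x_N]$, $\eta\ge3$, and let $H_1,\ldots,H_t\in S$ be an $\mathcal{R}_\eta$-sequence of forms in $S$. Consider the UFD $R=S/(H_1,\ldots,H_t)$. Suppose $g_1,\ldots,g_r,f_1,\ldots,f_s$ is a prime sequence of homogeneous elements in $R$. Let $P\in R$ be a square-free homogeneous element of degree $d\ge1$ such that $P\in\mathbb{K}[g_1,\ldots,g_r,f_1,\ldots,f_s]$ and $P\notin(f_1,\ldots,f_s)$ in $R$. Let $\mathcal{H}=\{Q_1,\ldots,Q_\ell\}\subset\mathbb{K}[f_1,\ldots,f_s]$ be such that: (1) $Q_i$ is square-free homogeneous of positive degree in $R$ for all $i\in\{1,\ldots,\ell\}$; (2) $Q_i,Q_j$ do not have common factors in $R$ for any $i\ne j$; (3) $(P,Q_i)$ is not radical in $R$ for all $i$. Then $|\mathcal{H}|=\ell\le d^2(2d-1)$. In particular, there exist at most $d^2(2d-1)$ distinct elements in $\mathbb{K}[f_1,\ldots,f_s]$ satisfying conditions (1), (2) and (3).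
   Context: A form is a homogeneous polynomial. A Noetherian ring satisfies $\mathcal{R}_\eta$ if its localizations at all primes of height at most $\eta$ are regular local rings. A sequence $F_1,\ldots,F_n$ in a Noetherian ring $R$ is a prime sequence (resp. an $\mathcal{R}_\eta$-sequence) if it is a regular sequence and $R/(F_1,\ldots,F_i)$ is an integral domain (resp. satisfies $\mathcal{R}_\eta$) for all $i\in\{1,\ldots,n\}$. If $\eta\ge3$, the quotient of a polynomial ring by an $\mathcal{R}_\eta$-sequence of forms is a Cohen-Macaulay UFD. *)

(* Defs.v *)
From HB Require Import structures.
From mathcomp Require Import all_boot all_order all_algebra.
From mathcomp Require Import boolp classical_sets cardinality.
From mathcomp Require Import mpoly ring.

Set Implicit Arguments.
Unset Strict Implicit.
Unset Printing Implicit Defensive.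

Import GRing.Theory.
Local Open Scope quotient_scope.
Local Open Scope classical_set_scope.
Local Open Scope ring_scope.

(* Rings are [comPzRingType]s, so that the zero ring is allowed: the quotient
   by an arbitrary ideal is then always a ring, and being nonzero is always an
   explicit requirement. *)

Record ideal (A : comPzRingType) := Ideal {
  ideal_set :> A -> Prop;
  ideal_zero : ideal_set 0;
  ideal_add : forall x y, ideal_set x -> ideal_set y -> ideal_set (x + y);
  ideal_mul : forall a x, ideal_set x -> ideal_set (a * x)
}.

Section Span.
Variables (A : comPzRingType) (s : seq A).

Definition span_set : set A :=
  [set x | exists c : 'I_(size s) -> A, x = \sum_(i < size s) c i * s`_i].

Fact span_zero : span_set 0.
Proof. by exists (fun=> 0); rewrite big1 // => i _; rewrite mul0r. Qed.

Fact span_add x y : span_set x -> span_set y -> span_set (x + y).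
Proof.
move=> [c ->] [e ->]; exists (fun i => c i + e i).
by rewrite -big_split; apply: eq_bigr => i _; rewrite mulrDl.
Qed.

Fact span_mul a x : span_set x -> span_set (a * x).
Proof.
move=> [c ->]; exists (fun i => a * c i).
by rewrite mulr_sumr; apply: eq_bigr => i _; rewrite mulrA.
Qed.

Definition ideal_span : ideal A := Ideal span_zero span_add span_mul.
End Span.

Section IdealQuotient.
Variables (A : comPzRingType) (I : ideal A).

Definition ideal_mem : A -> bool := fun x => `[< I x >].

Fact ideal_mem_zmod_closed : zmod_closed ideal_mem.
Proof.
split=> [|x y /asboolP Ix /asboolP Iy]; apply/asboolP; first exact: ideal_zero.
by apply: ideal_add => //; rewrite -mulN1r; apply: ideal_mul.
Qed.

HB.instance Definition _ :=
  GRing.isZmodClosed.Build A ideal_mem ideal_mem_zmod_closed.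

Definition ideal_zmod : zmodClosed A := GRing.ZmodClosed.clone A ideal_mem _.

Definition ideal_quotient : Type := Quotient.quot ideal_zmod.

HB.instance Definition _ := GRing.Zmodule.on ideal_quotient.
HB.instance Definition _ :=
  EqQuotient.copy ideal_quotient (Quotient.quot ideal_zmod).

Let Q := ideal_quotient.

Fact quot_piP (x y : A) : reflect (I (x - y)) (\pi_Q x == \pi_Q y).
Proof.
rewrite -(Quotient.idealrBE ideal_zmod); exact: asboolP.
Qed.

Definition quot_one : Q := \pi_Q 1.
Definition quot_mul := lift_op2 Q *%R.

Fact quot_mulE (x y : A) : quot_mul (\pi_Q x) (\pi_Q y) = \pi_Q (x * y).
Proof.
unlock quot_mul; apply/eqP/quot_piP; set x' := repr _; set y' := repr _.
have Ix : I (x' - x) by apply/quot_piP; rewrite reprK.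
have Iy : I (y' - y) by apply/quot_piP; rewrite reprK.
have -> : x' * y' - x * y = y' * (x' - x) + x * (y' - y).
  by rewrite !mulrBr [y' * x']mulrC [y' * x]mulrC addrA subrK.
by apply: ideal_add; apply: ideal_mul.
Qed.

Fact quot_addE (x y : A) : \pi_Q x + \pi_Q y = \pi_Q (x + y).
Proof. by have /= -> := (@Quotient.pi_add A ideal_zmod x y). Qed.

Fact quot_mulA : associative quot_mul.
Proof.
by move=> x y z; rewrite -[x]reprK -[y]reprK -[z]reprK !quot_mulE mulrA.
Qed.

Fact quot_mulC : commutative quot_mul.
Proof. by move=> x y; rewrite -[x]reprK -[y]reprK !quot_mulE mulrC. Qed.

Fact quot_mul1 : left_id quot_one quot_mul.
Proof. by move=> x; rewrite -[x]reprK quot_mulE mul1r. Qed.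

Fact quot_mulDl : left_distributive quot_mul +%R.
Proof.
move=> x y z; rewrite -[x]reprK -[y]reprK -[z]reprK.
by rewrite quot_addE !quot_mulE quot_addE mulrDl.
Qed.

HB.instance Definition _ := GRing.Zmodule_isComPzRing.Build ideal_quotient
  quot_mulA quot_mulC quot_mul1 quot_mulDl.

Definition quot_proj (x : A) : ideal_quotient := \pi_Q x.
End IdealQuotient.

Record prime_ideal (A : comPzRingType) := PrimeIdeal {
  prime_ideal_ideal :> ideal A;
  prime_ideal_proper : ~ prime_ideal_ideal 1;
  prime_ideal_prime : forall x y, prime_ideal_ideal (x * y) ->
    prime_ideal_ideal x \/ prime_ideal_ideal y
}.

Section Localization.
Variables (A : comPzRingType) (p : prime_ideal A).

Definition prefraction : Type := (A * {s : A | `[< ~ p s >]})%type.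
HB.instance Definition _ := Choice.on prefraction.

Definition pf_num (x : prefraction) : A := x.1.
Definition pf_den (x : prefraction) : A := val x.2.

Fact denP (x : prefraction) : ~ p (pf_den x).
Proof. exact/asboolP/(valP x.2). Qed.

Fact den_mulP (s t : A) : ~ p s -> ~ p t -> ~ p (s * t).
Proof. by move=> ps pt /prime_ideal_prime[]. Qed.

Definition mkfraction (a s : A) (ps : ~ p s) : prefraction :=
  (a, Sub s (asboolT ps)).

(* A may have zero divisors: a/s = b/t iff u(at - bs) = 0 for some u off p. *)
Definition fraction_eqv (x y : prefraction) : bool :=
  `[< exists2 u, ~ p u & u * (pf_num x * pf_den y) = u * (pf_num y * pf_den x) >].

Fact fraction_eqv_is_equiv : equiv_class_of fraction_eqv.
Proof.
split=> [x|x y|y x z].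
- by apply/asboolP; exists 1 => //; apply: prime_ideal_proper.
- by apply/asboolP/asboolP => -[u pu e]; exists u.
move=> /asboolP[u pu e] /asboolP[v pv f]; apply/asboolP.
exists (u * v * pf_den y); first by do 2?[apply: den_mulP => //]; apply: denP.
have -> : u * v * pf_den y * (pf_num x * pf_den z)
        = u * (pf_num x * pf_den y) * (v * pf_den z) by ring.
have -> : u * v * pf_den y * (pf_num z * pf_den x)
        = u * pf_den x * (v * (pf_num z * pf_den y)) by ring.
by rewrite e -f; ring.
Qed.

Canonical fraction_equiv := EquivRelPack fraction_eqv_is_equiv.
Canonical fraction_encModRel := defaultEncModRel fraction_eqv.

Definition localization : Type := {eq_quot fraction_eqv}.
HB.instance Definition _ := Choice.on localization.
HB.instance Definition _ := EqQuotient.copy localization {eq_quot fraction_eqv}.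

Let L := localization.

Fact loc_piP (x y : prefraction) :
  \pi_L x = \pi_L y <->
  exists2 u, ~ p u & u * (pf_num x * pf_den y) = u * (pf_num y * pf_den x).
Proof.
split=> [/eqP|h]; first by rewrite eqquotE => /asboolP.
by apply/eqP; rewrite eqquotE; apply/asboolP.
Qed.

Definition pf_zero : prefraction := mkfraction 0 (@prime_ideal_proper _ p).
Definition pf_one : prefraction := mkfraction 1 (@prime_ideal_proper _ p).
Definition pf_opp (x : prefraction) : prefraction :=
  mkfraction (- pf_num x) (@denP x).
Definition pf_add (x y : prefraction) : prefraction :=
  mkfraction (pf_num x * pf_den y + pf_num y * pf_den x) (den_mulP (@denP x) (@denP y)).
Definition pf_mul (x y : prefraction) : prefraction :=
  mkfraction (pf_num x * pf_num y) (den_mulP (@denP x) (@denP y)).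

Definition loc_zero : L := \pi_L pf_zero.
Definition loc_one : L := \pi_L pf_one.
Definition loc_opp := lift_op1 L pf_opp.
Definition loc_add := lift_op2 L pf_add.
Definition loc_mul := lift_op2 L pf_mul.

Fact loc_oppE x : loc_opp (\pi_L x) = \pi_L (pf_opp x).
Proof.
unlock loc_opp; apply/loc_piP; set x' := repr _.
have /loc_piP[u pu e] : \pi_L x' = \pi_L x by rewrite reprK.
exists u => //; rewrite /pf_num /pf_den /= -!/(pf_num _) -!/(pf_den _).
by rewrite !mulNr !mulrN e.
Qed.

Fact loc_addE x y : loc_add (\pi_L x) (\pi_L y) = \pi_L (pf_add x y).
Proof.
unlock loc_add; apply/loc_piP; set x' := repr _; set y' := repr _.
have /loc_piP[u pu e] : \pi_L x' = \pi_L x by rewrite reprK.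
have /loc_piP[v pv f] : \pi_L y' = \pi_L y by rewrite reprK.
exists (u * v); first exact: den_mulP.
rewrite /pf_num /pf_den /= -!/(pf_num _) -!/(pf_den _).
transitivity (u * (pf_num x' * pf_den x) * (v * pf_den y * pf_den y')
            + v * (pf_num y' * pf_den y) * (u * pf_den x * pf_den x')); first by ring.
by rewrite e f; ring.
Qed.

Fact loc_mulE x y : loc_mul (\pi_L x) (\pi_L y) = \pi_L (pf_mul x y).
Proof.
unlock loc_mul; apply/loc_piP; set x' := repr _; set y' := repr _.
have /loc_piP[u pu e] : \pi_L x' = \pi_L x by rewrite reprK.
have /loc_piP[v pv f] : \pi_L y' = \pi_L y by rewrite reprK.
exists (u * v); first exact: den_mulP.
rewrite /pf_num /pf_den /= -!/(pf_num _) -!/(pf_den _).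
transitivity (u * (pf_num x' * pf_den x) * (v * (pf_num y' * pf_den y))); first by ring.
by rewrite e f; ring.
Qed.

Local Ltac fraction_eq :=
  apply/loc_piP; exists 1; [exact: prime_ideal_proper
  | rewrite /pf_add /pf_mul /pf_opp /pf_num /pf_den /=; ring].

Fact loc_addA : associative loc_add.
Proof.
move=> x y z; rewrite -[x]reprK -[y]reprK -[z]reprK !loc_addE; fraction_eq.
Qed.

Fact loc_addC : commutative loc_add.
Proof. move=> x y; rewrite -[x]reprK -[y]reprK !loc_addE; fraction_eq. Qed.

Fact loc_add0 : left_id loc_zero loc_add.
Proof. move=> x; rewrite -[x]reprK loc_addE; fraction_eq. Qed.

Fact loc_addN : left_inverse loc_zero loc_opp loc_add.
Proof. move=> x; rewrite -[x]reprK loc_oppE loc_addE; fraction_eq. Qed.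

Fact loc_mulA : associative loc_mul.
Proof.
move=> x y z; rewrite -[x]reprK -[y]reprK -[z]reprK !loc_mulE; fraction_eq.
Qed.

Fact loc_mulC : commutative loc_mul.
Proof. move=> x y; rewrite -[x]reprK -[y]reprK !loc_mulE; fraction_eq. Qed.

Fact loc_mul1 : left_id loc_one loc_mul.
Proof. move=> x; rewrite -[x]reprK loc_mulE; fraction_eq. Qed.

Fact loc_mulDl : left_distributive loc_mul loc_add.
Proof.
move=> x y z; rewrite -[x]reprK -[y]reprK -[z]reprK.
rewrite !(loc_addE, loc_mulE); fraction_eq.
Qed.

HB.instance Definition _ :=
  GRing.isZmodule.Build localization loc_addA loc_addC loc_add0 loc_addN.
HB.instance Definition _ := GRing.Zmodule_isComPzRing.Build localization
  loc_mulA loc_mulC loc_mul1 loc_mulDl.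
End Localization.

Section RingNotions.
Variable A : comPzRingType.
Implicit Types (s : seq A) (a b : A).

Definition is_unit a := exists b, a * b = 1.

Definition divides a b := exists c, b = a * c.

Definition square_free a := forall b, divides (b * b) a -> is_unit b.

Definition no_common_factor a b :=
  forall c, divides c a -> divides c b -> is_unit c.

Definition radical_ideal (I : ideal A) := forall a n, I (a ^+ n.+1) -> I a.

Definition integral_domain :=
  (1 : A) <> 0 /\ forall a b, a * b = 0 -> a = 0 \/ b = 0.

Definition noetherian :=
  forall I : ideal A, exists s, (I : set A) = ideal_span s.

Definition prime_chain n (q : 'I_n.+1 -> prime_ideal A) :=
  forall i j : 'I_n.+1, (i < j)%N -> (q i : set A) `<` q j.

Definition krull_dim n :=
  (exists q : 'I_n.+1 -> prime_ideal A, prime_chain q) /\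
  forall m (q : 'I_m.+1 -> prime_ideal A), prime_chain q -> (m <= n)%N.

Definition height_le (p : prime_ideal A) n :=
  forall m (q : 'I_m.+1 -> prime_ideal A),
    prime_chain q -> (q ord_max : set A) = p -> (m <= n)%N.

Definition maximal_ideal (m : ideal A) :=
  ~ m 1 /\ forall J : ideal A, (m : set A) `<=` J -> ~ J 1 -> (J : set A) = m.

Definition regular_local_ring :=
  noetherian /\
  exists m : ideal A,
    [/\ maximal_ideal m,
        forall m' : ideal A, maximal_ideal m' -> (m' : set A) = m
      & exists s, krull_dim (size s) /\ (m : set A) = ideal_span s].

(* F_1, ..., F_n is regular when each F_i is a nonzerodivisor modulo
   (F_1, ..., F_(i-1)) and A/(F_1, ..., F_n) is nonzero. *)
Definition regular_sequence s :=
  (forall i, (i < size s)%N ->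
     forall x : ideal_quotient (ideal_span (take i s)),
       quot_proj (ideal_span (take i s)) s`_i * x = 0 -> x = 0) /\
  (1 : ideal_quotient (ideal_span s)) <> 0.
End RingNotions.

Definition serre_R (eta : nat) (A : comPzRingType) :=
  forall p : prime_ideal A, height_le p eta ->
    regular_local_ring (localization p).

Definition prime_sequence (A : comPzRingType) (s : seq A) :=
  regular_sequence s /\
  forall i, (0 < i <= size s)%N ->
    integral_domain (ideal_quotient (ideal_span (take i s))).

Definition R_sequence (eta : nat) (A : comPzRingType) (s : seq A) :=
  regular_sequence s /\
  forall i, (0 < i <= size s)%N ->
    serre_R eta (ideal_quotient (ideal_span (take i s))).

Section GradedQuotient.
Variables (K : fieldType) (N : nat) (I : ideal {mpoly K[N]}).
Let R := ideal_quotient I.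

(* For I generated by forms: the degree d component of the graded ring S/I. *)
Definition homog_of_degree (d : nat) (a : R) :=
  exists2 p : {mpoly K[N]}, p \is d.-homog & a = quot_proj I p.

Definition homogeneous (a : R) := exists d, homog_of_degree d a.

(* The K-subalgebra K[s_0, ..., s_(n-1)] of S/I; the right-hand side is the
   value of q at s, spelled out because [mmap] requires a nonzero target. *)
Definition subalgebra (s : seq R) : set R :=
  [set a | exists q : {mpoly K[size s]},
     a = \sum_(m <- msupp q)
           quot_proj I (q@_m)%:MP * \prod_(i < size s) s`_i ^+ m i].
End GradedQuotient.

(* Main.v *)
Require Import Defs.
From HB Require Import structures.
From mathcomp Require Import all_boot all_order all_algebra perm separable.
From mathcomp Require Import boolp classical_sets cardinality.
From mathcomp Require Import mpoly ring zify.

(* Let A = K[y_1, ..., y_n] map to R = S/(H) by y_i |-> the i-th element of g ++ f.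
   Since g ++ f is a regular sequence of forms, every fiber R/(g - a, f - b) carries a
   degree filtration whose graded ring is the domain R/(g, f); hence all fibers are
   nonzero and reduced, and finitely many monomials of S that are independent in
   R/(g, f) stay independent in all fibers and span a given piece of R over A.  So an
   element of R whose power lies in (P, Q) has coefficients in A vanishing on V(p, q),
   where p, q in A represent P, Q, and units and common factors in R come from A.
   This reduces everything to the factorial ring A.

   As P is not in (f), there is a point c with p(c) <> 0 whose f-coordinates are zero.
   Along the flow y_i + c_i t^(w_i) the polynomial p is monic of degree d in t, with a
   discriminant D in A of degree at most d (2d - 1), nonzero as p is square-free, while
   q in K[f] is constant.  If q is square-free and prime to D, division by p along the
   flow shows that any h vanishing on V(p, q) lies in (p, q): D times each coefficient of
   the remainder vanishes on V(q), hence q divides it.  Thus each Q with (P, Q) not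
   radical shares a prime factor with D, and coprime Q's give distinct prime factors. *)

Set Implicit Arguments.
Unset Strict Implicit.
Unset Printing Implicit Defensive.

Import GRing.Theory.
Local Open Scope classical_set_scope.
Local Open Scope ring_scope.

(** * Divisibility and prime factorizations *)

Definition prime_elt (A : comPzRingType) (p : A) :=
  [/\ p <> 0, ~ is_unit p &
      forall a b, divides p (a * b) -> divides p a \/ divides p b].

Definition prime_factored (D : idomainType) (a : D) := exists u (s : seq D),
  [/\ is_unit u, forall p, p \in s -> prime_elt p & a = u * \prod_(p <- s) p].

(** The factors are prime and not only irreducible, so uniqueness is automatic and existence alone
    makes [D] a UFD. *)
Definition factorial (D : idomainType) := forall a : D, a <> 0 -> prime_factored a.

Section Divides.
Variable A : comPzRingType.
Implicit Types a b c : A.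

Lemma dividesxx a : divides a a.
Proof. by exists 1; rewrite mulr1. Qed.

Lemma divides_mulr a b : divides a (a * b).
Proof. by exists b. Qed.

Lemma divides_mull a b : divides a (b * a).
Proof. by exists b; rewrite mulrC. Qed.

Lemma divides_trans b a c : divides a b -> divides b c -> divides a c.
Proof. by move=> [x ->] [y ->]; exists (x * y); rewrite mulrA. Qed.

Lemma dividesD a b c : divides a b -> divides a c -> divides a (b + c).
Proof. by move=> [x ->] [y ->]; exists (x + y); rewrite mulrDr. Qed.

Lemma dividesB a b c : divides a b -> divides a c -> divides a (b - c).
Proof. by move=> [x ->] [y ->]; exists (x - y); rewrite mulrBr. Qed.

Lemma divides0 a : divides a 0.
Proof. by exists 0; rewrite mulr0. Qed.

Lemma divides_sum a (I : Type) (r : seq I) (P : pred I) (F : I -> A) :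
  (forall i, P i -> divides a (F i)) -> divides a (\sum_(i <- r | P i) F i).
Proof.
move=> h; elim/big_ind: _ => //; [exact: divides0 | exact: dividesD].
Qed.

Lemma is_unit1 : is_unit (1 : A).
Proof. by exists 1; rewrite mulr1. Qed.

Lemma is_unitM a b : is_unit a -> is_unit b -> is_unit (a * b).
Proof. by move=> [x e] [y f]; exists (x * y); rewrite mulrACA e f mulr1. Qed.

Lemma is_unit_divides a b : is_unit b -> divides a b -> is_unit a.
Proof. by move=> [x e] [y f]; exists (y * x); rewrite mulrA -f. Qed.

Lemma unit_divides u a : is_unit u -> divides u a.
Proof. by move=> [v e]; exists (v * a); rewrite mulrA e mul1r. Qed.

Lemma divides_unitl u a b : is_unit u -> divides a (u * b) -> divides a b.
Proof.
move=> [v e] [x f]; exists (x * v).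
by rewrite mulrA -f mulrAC e mul1r.
Qed.

Lemma prime_divides_prod (p : A) (s : seq A) : prime_elt p ->
  divides p (\prod_(q <- s) q) -> exists2 q, q \in s & divides p q.
Proof.
move=> [_ np pp]; elim: s => [|q s IHs].
  by rewrite big_nil => /(is_unit_divides is_unit1).
rewrite big_cons => /pp[pq | /IHs[r rs pr]].
  by exists q => //; rewrite inE eqxx.
by exists r => //; rewrite inE rs orbT.
Qed.
End Divides.

Lemma prime_factoredM (D : idomainType) (a b : D) :
  prime_factored a -> prime_factored b -> prime_factored (a * b).
Proof.
move=> [u [s [uu sp ->]]] [v [t [uv tp ->]]]; exists (u * v), (s ++ t); split.
- exact: is_unitM.
- by move=> p; rewrite mem_cat => /orP[/sp|/tp].
- by rewrite big_cat /= mulrACA.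
Qed.

Lemma prime_factored_prime (D : idomainType) (p : D) : prime_elt p -> prime_factored p.
Proof.
move=> pp; exists 1, [:: p]; split; first exact: is_unit1.
  by move=> q; rewrite inE => /eqP ->.
by rewrite big_seq1 mul1r.
Qed.

Section FactorialTheory.
Variable D : idomainType.
Implicit Types a b c p q u : D.

(** Write q = p u. The prime q divides p or u, and in the second case p would be a unit. *)
Lemma prime_associate p q : prime_elt p -> prime_elt q -> divides p q ->
  exists2 u, is_unit u & q = p * u.
Proof.
move=> [p0 np pp] [q0 nq qp] [u e]; exists u => //.
case: (qp p u); first by rewrite -e; apply: dividesxx.
  move=> [v f]; exists v; apply: (@mulIf _ q); first exact/eqP.
  by rewrite mul1r [RHS]e f; ring.
move=> [v f]; case: np; exists v; apply: (@mulIf _ u).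
  by apply/eqP => u0; apply: q0; rewrite e u0 mulr0.
by rewrite mul1r [RHS]f e; ring.
Qed.

Lemma factorial_prime_divisor a : factorial D -> a <> 0 -> ~ is_unit a ->
  exists2 p, prime_elt p & divides p a.
Proof.
move=> fD /fD[u [[|p s] [uu sp e]]] na; first by case: na; rewrite e big_nil mulr1.
exists p; first by apply: sp; rewrite inE eqxx.
by rewrite e big_cons mulrCA; apply: divides_mulr.
Qed.

(** Each prime factor of [a] divides [b * c] but not [b], hence divides [c] and can be cancelled;
    induction on the number of factors. *)
Lemma factorial_coprime_divides a b c : factorial D -> a <> 0 ->
  (forall p, prime_elt p -> divides p a -> ~ divides p b) ->
  divides a (b * c) -> divides a c.
Proof.
move=> fD /fD[u [s [uu sp ->]]]; elim: s c sp => [|p s IHs] c sp nb.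
  by rewrite big_nil mulr1 => _; apply: unit_divides.
have pp : prime_elt p by apply: sp; rewrite inE eqxx.
have sp' q : q \in s -> prime_elt q by move=> qs; apply: sp; rewrite inE qs orbT.
rewrite big_cons mulrCA => -[x e].
have [p0 _ pP] := pp.
case: (pP b c); first by rewrite e -mulrA; apply: divides_mulr.
  by move=> /nb; case=> //; rewrite big_cons mulrCA; apply: divides_mulr.
move=> [c' ec]; have : divides (u * \prod_(q <- s) q) c'.
  apply: IHs => // [q qq qd|]; first apply: (nb) => //.
    by rewrite big_cons mulrCA; apply: divides_trans qd (divides_mull _ _).
  exists x; apply: (@mulfI _ p); first exact/eqP.
  by rewrite mulrCA -ec e -!mulrA.
by move=> [y ec']; exists y; rewrite ec ec' !mulrA.
Qed.
End FactorialTheory.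

(** * Gauss's lemma: polynomials over a factorial domain *)

Section PolyFactorial.
Variable D : idomainType.
Implicit Types (F G H : {poly D}) (p a b c : D).

Lemma dividesCP p F : divides p%:P F <-> forall i, divides p F`_i.
Proof.
split=> [[G ->] i|h]; first by rewrite coefCM; apply: divides_mulr.
have {}h i := cid (h i).
exists (\poly_(i < size F) sval (h i)).
apply/polyP => i; rewrite coefCM coef_poly; case: ltnP => [_|/leq_sizeP -> //].
  exact: svalP (h i).
by rewrite mulr0.
Qed.

Lemma is_unitC p : is_unit p%:P <-> is_unit p.
Proof.
split=> [[G e]|[v e]]; last by exists v%:P; rewrite -polyCM e.
by exists G`_0; rewrite -coefCM e coef1.
Qed.

Lemma is_unit_size F : is_unit F -> size F = 1%N.
Proof.
move=> [G e]; have {}e : F * (G : {poly D}) = 1 by [].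
have : F * (G : {poly D}) != 0 by rewrite e oner_neq0.
rewrite mulf_eq0 negb_or -!size_poly_gt0 => /andP[F0 G0].
have := congr1 (size \o val) e; rewrite /= size_mul -?size_poly_gt0 // size_poly1.
by case: (size F) F0 => [|[|a]] //; case: (size G) G0 => [|[|b]] //=; rewrite ?addnS.
Qed.

(** If p divides neither F nor G, take the least i and j for which it misses the coefficients of F
    and G. In the coefficient of F G of degree i + j every other term is divisible by p. *)
Lemma prime_eltC p : prime_elt p -> prime_elt p%:P.
Proof.
move=> [p0 np pP]; split; [by move/polyC_inj | by move/is_unitC|].
move=> F G pFG; apply: contrapT => /not_orP[nF nG].
have exF : exists i, ~~ `[< divides p F`_i >].
  apply: contrapT => h; apply: nF; apply/dividesCP => i.
  by apply: contrapT => hi; apply: h; exists i; apply/asboolPn.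
have exG : exists i, ~~ `[< divides p G`_i >].
  apply: contrapT => h; apply: nG; apply/dividesCP => i.
  by apply: contrapT => hi; apply: h; exists i; apply/asboolPn.
case: (ex_minnP exF) => i /asboolPn ni mini.
case: (ex_minnP exG) => j /asboolPn nj minj.
have : divides p (F`_i * G`_j).
  have /dividesCP/(_ (i + j)%N) := pFG; rewrite coefM.
  have lti : (i < (i + j).+1)%N by rewrite ltnS leq_addr.
  rewrite (bigD1 (Ordinal lti)) //= addKn => h.
  have -> : F`_i * G`_j = F`_i * G`_j + \sum_(i0 < (i + j).+1 | i0 != Ordinal lti)
      F`_i0 * G`_(i + j - i0) - \sum_(i0 < (i + j).+1 | i0 != Ordinal lti)
      F`_i0 * G`_(i + j - i0) by rewrite addrK.
  apply: dividesB => //; apply: divides_sum => k.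
  rewrite -val_eqE /= neq_ltn => /orP[ki|ik].
    apply: divides_trans (divides_mulr _ _).
    by apply: contrapT => /asboolPn /mini; rewrite leqNgt ki.
  apply: divides_trans (divides_mull _ _).
  apply: contrapT => /asboolPn /minj; rewrite leqNgt.
  by rewrite ltn_subLR ?ltn_add2r ?ik // -ltnS.
by case/pP.
Qed.

Hypothesis fD : factorial D.

(** Clearing denominators: each prime factor of [c] stays prime in [{poly D}], so it divides [F] or
    [G] and can be charged to that factor. *)
Lemma factorial_strip c F G H : c <> 0 -> c%:P * H = F * G ->
  exists a b F' G', [/\ F = a%:P * F', G = b%:P * G', H = F' * G', a <> 0 & b <> 0].
Proof.
move=> /fD[u [s [uu sp ->]]]; elim: s F G H sp => [|p s IHs] F G H sp.
  have [v e] := uu; rewrite big_nil mulr1 => f.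
  exists u, 1, (v%:P * F), G; split; rewrite ?mul1r //.
  - by rewrite mulrA -polyCM e mul1r.
  - by rewrite -mulrA -f mulrA -polyCM [v * u]mulrC e mul1r.
  - by move=> u0; have := oner_neq0 D; rewrite -e u0 mul0r eqxx.
  - exact/eqP/oner_neq0.
have pp : prime_elt p by apply: sp; rewrite inE eqxx.
have sp' q : q \in s -> prime_elt q by move=> qs; apply: sp; rewrite inE qs orbT.
have [p0 _ _] := pp; have [P0 _ PP] := prime_eltC pp.
rewrite big_cons mulrCA polyCM -mulrA => e.
case: (PP F G); first by rewrite -e; apply: divides_mulr.
  move=> [F1 f]; case: (IHs F1 G H sp').
    by apply: (@mulfI _ p%:P); [exact/eqP | rewrite e f mulrA].
  move=> a [b [F' [G' [e1 e2 e3 a0 b0]]]].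
  exists (p * a), b, F', G'; split=> //; first by rewrite f e1 polyCM mulrA.
  by apply/eqP; rewrite mulf_neq0 //; apply/eqP.
move=> [F1 f]; case: (IHs F F1 H sp').
  by apply: (@mulfI _ p%:P); [exact/eqP | rewrite e f mulrCA].
move=> a [b [F' [G' [e1 e2 e3 a0 b0]]]].
exists a, (p * b), F', G'; split=> //; first by rewrite f e2 polyCM mulrA.
by apply/eqP; rewrite mulf_neq0 //; apply/eqP.
Qed.

(** If F divides G H, a nonzero element m of least size in the ideal (F, G) divides F and G up to
    constants. By irreducibility of F, either m is a constant, and a Bezout relation gives that F
    divides H, or m is associated to F up to a constant, and F divides G. *)
Lemma irreducible_prime F : (1 < size F)%N ->
  (forall G H, F = G * H -> is_unit G \/ is_unit H) -> prime_elt F.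
Proof.
move=> sF irr; have F0 : F != 0 by rewrite -size_poly_gt0 ltnW.
split; [exact/eqP | by move/is_unit_size => e; rewrite e in sF|].
(* A constant can be removed from a multiple of [F]: the constant part of [F] is a unit because [F]
   is irreducible of positive degree. *)
have key c G (K : {poly D}) : c <> 0 -> c%:P * G = F * K -> divides F G.
  move=> c0 /(factorial_strip c0)[a [b [F' [G' [e1 _ -> a0 _]]]]].
  have [ua|uF'] := irr _ _ e1.
    by apply: divides_trans (divides_mulr _ _); case: ua => v e;
      exists v; rewrite e1 mulrAC e mul1r.
  by move: sF; rewrite e1 size_Cmul ?(is_unit_size uF') //; apply/eqP.
move=> G H [k eGH]; apply: contrapT => /not_orP[nG nH].
pose I (m : {poly D}) := exists a b : {poly D}, m = a * F + b * G.
pose Q n := `[< exists m, [/\ m <> 0, I m & size m = n] >].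
have exQ : exists n, Q n.
  exists (size F); apply/asboolP; exists F; split=> //; first exact/eqP.
  by exists (1 : {poly D}), 0; rewrite mul1r mul0r addr0.
case: (ex_minnP exQ) => n /asboolP[m [m0 [a [b em]] sm]] minn.
(* Pseudo-division: the remainder stays in the ideal and is smaller than [m], so it vanishes. *)
have div K : I K -> exists2 c, c <> 0 & exists q, c%:P * K = m * q.
  move=> [a' [b' eK]]; have := Pdiv.Idomain.divp_eq K m.
  set c := _ ^+ _; have c0 : c <> 0.
    by apply/eqP; rewrite expf_neq0 // lead_coef_eq0; apply/eqP.
  move=> e; exists c => //; exists (K %/ m)%R; rewrite mul_polyC e mulrC.
  suff -> : K %% m = 0 by rewrite addr0.
  apply: contrapT => r0; have := ltn_modp K m; rewrite (introN eqP m0) ltnNge.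
  rewrite sm minn //; apply/asboolP; exists (K %% m); split=> //.
  exists (c%:P * a' - (K %/ m) * a), (c%:P * b' - (K %/ m) * b).
  have -> : K %% m = c *: K - K %/ m * m by rewrite e addrC addKr.
  by rewrite -mul_polyC eK em; ring.
have [c0 c0n [q0 e0]] : exists2 c, c <> 0 & exists q, c%:P * F = m * q.
  by apply: div; exists (1 : {poly D}), 0; rewrite mul1r mul0r addr0.
have [c1 c1n [q1 e1]] : exists2 c, c <> 0 & exists q, c%:P * G = m * q.
  by apply: div; exists (0 : {poly D}), 1; rewrite mul1r mul0r add0r.
case: (factorial_strip c0n e0) => x [y [m' [q' [em' eq' eF x0 y0]]]].
case: (irr _ _ eF) => [um|uq].
  have mc : m = (x * m'`_0)%:P.
    have /size_poly1P[c _ em'c] : size m' == 1%N by rewrite (is_unit_size um).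
    by rewrite em' em'c coefC polyCM.
  apply: nH; apply: (key (x * m'`_0) H (a * H + b * k)).
    by move=> xm; apply: m0; rewrite mc xm.
  by rewrite -mc em mulrDl -!mulrA eGH; ring.
case: uq => v ev; apply: nG; apply: (key c1 G (v * x%:P * q1)) => //.
by rewrite e1 em' eF; transitivity (q' * v * (x%:P * m' * q1)); [rewrite ev mul1r | ring].
Qed.

(** Induction on the size of F, then on the number of primes in its leading coefficient. Constant
    primes are removed first, then F is split into factors of positive degree; if neither is
    possible, F is irreducible. *)
Lemma factorial_poly : factorial {poly D}.
Proof.
move=> F /eqP F0.
have PC a : a <> 0 -> prime_factored (a%:P : {poly D}).
  move=> /fD[u [s [uu sp ->]]]; exists u%:P, [seq p%:P | p <- s]; split.
  - exact/is_unitC.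
  - by move=> _ /mapP[p /sp pp ->]; apply: prime_eltC.
  - by rewrite polyCM rmorph_prod big_map.
have [n] := ubnP (size F); elim: n F F0 => // n IHn F F0 sFn.
have lF0 : lead_coef F <> 0 by apply/eqP; rewrite lead_coef_eq0.
have [u [s [uu sp e]]] := fD lF0.
have [k] := ubnP (size s); elim: k s u F F0 sFn uu sp e {lF0} => // k IHk s u F F0 sFn uu sp e sk.
have [sF|sF] := leqP (size F) 1.
  by rewrite [F]size1_polyC //; apply: PC => f0; move: F0; rewrite [F]size1_polyC // f0 eqxx.
have [[p pp pF]|noC] := pselect (exists2 p, prime_elt p & divides p%:P F).
  have [p0 np pP] := pp; have [F1 eF] := pF.
  have F10 : F1 != 0 by apply: contra_neq F0 => f; rewrite eF f mulr0.
  have sF1 : size F1 = size F by rewrite eF size_Cmul //; apply/eqP.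
  have eL : lead_coef F = p * lead_coef F1 by rewrite eF lead_coefM lead_coefC.
  (* The constant prime [p] also divides the leading coefficient, so it is associated to a member of
     [s]; removing that member lowers the inner count. *)
  have [q qs pq] : exists2 q, q \in s & divides p q.
    apply: (prime_divides_prod pp); apply: (@divides_unitl _ u) => //.
    by rewrite -e eL; apply: divides_mulr.
  have [v uv eq] := prime_associate pp (sp q qs) pq.
  rewrite eF; apply: prime_factoredM.
    by apply: PC.
  apply: (IHk (rem q s) (u * v)); rewrite ?sF1 //.
  - exact: is_unitM.
  - by move=> r /mem_rem /sp.
  - apply: (@mulfI _ p); first exact/eqP.
    by rewrite -eL e (big_rem q) //= {1}eq; ring.
  - by rewrite size_rem //; case: (s) qs sk.
have [[G [H [eF sG sH]]]|irr] := pselect (exists G H : {poly D},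
    [/\ F = G * H, (1 < size G)%N & (1 < size H)%N]).
  have G0 : G != 0 by rewrite -size_poly_gt0 ltnW.
  have H0 : H != 0 by rewrite -size_poly_gt0 ltnW.
  have := size_mul G0 H0; rewrite -eF => sGH.
  by rewrite eF; apply: prime_factoredM; apply: IHn; rewrite //; lia.
apply: prime_factored_prime; apply: irreducible_prime => // G H eF.
have small (A B : {poly D}) : F = A * B -> (size A <= 1)%N -> is_unit A.
  move=> eAB sA; have A0 : A`_0 <> 0.
    by move=> a0; move: F0; rewrite eAB [A]size1_polyC // a0 mul0r eqxx.
  rewrite [A]size1_polyC //; apply/is_unitC; apply: contrapT => nu.
  have [p pp pa] := factorial_prime_divisor fD A0 nu.
  apply: noC; exists p => //; rewrite eAB [A]size1_polyC //.
  by apply: divides_trans (divides_mulr _ _); case: pa => c ->; rewrite polyCM; apply: divides_mulr.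
have [sG|sG] := leqP (size G) 1; first by left; apply: small eF sG.
have [sH|sH] := leqP (size H) 1; first by right; apply: (small H G) => //; rewrite mulrC.
by case: irr; exists G, H.
Qed.
End PolyFactorial.

Lemma factorial_iso (D E : idomainType) (f : {rmorphism D -> E}) (g : E -> D) :
  cancel f g -> cancel g f -> factorial E -> factorial D.
Proof.
move=> fK gK fE a a0.
have fdiv x y : divides x y -> divides (f x) (f y).
  by move=> [c ->]; exists (f c); rewrite rmorphM.
have gM : {morph g : x y / x * y} by move=> x y; apply: (can_inj fK); rewrite rmorphM !gK.
have gdiv x y : divides x y -> divides (g x) (g y).
  by move=> [c ->]; exists (g c); rewrite gM.
have g1 : g 1 = 1 by apply: (can_inj fK); rewrite rmorph1 gK.
have gu x : is_unit x -> is_unit (g x) by move=> [c e]; exists (g c); rewrite -gM e g1.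
have [u [s [uu sp e]]] : prime_factored (f a).
  by apply: fE => /(congr1 g); rewrite fK -(rmorph0 f) fK.
exists (g u), [seq g p | p <- s]; split; first exact: gu.
  move=> _ /mapP[p /sp[p0 np pP] ->]; split.
  - by move=> /(congr1 f); rewrite gK rmorph0.
  - by move=> [c e']; apply: np; exists (f c); rewrite -[p]gK -rmorphM e' rmorph1.
  - by move=> x y /fdiv; rewrite gK rmorphM => /pP[] /gdiv; rewrite fK; [left | right].
rewrite -[a]fK e gM big_map; congr (_ * _).
by rewrite (big_morph g gM g1).
Qed.

Lemma mpoly_rmorph_eq n (R S : comNzRingType) (f g : {rmorphism {mpoly R[n]} -> S}) :
  (forall c, f c%:MP = g c%:MP) -> (forall i, f 'X_i = g 'X_i) -> f =1 g.
Proof.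
move=> fC fX p; elim/mpolyind: p => [|c m p _ _ IHp]; first by rewrite !rmorph0.
rewrite !rmorphD IHp -mul_mpolyC !rmorphM fC; congr (_ * _ + _).
by rewrite mpolyXE_id !rmorph_prod; apply: eq_bigr => i _; rewrite !rmorphXn /= fX.
Qed.

(** * Factoriality of multivariate polynomial rings over a field *)

Section MPolyFactorial.
Variable K : fieldType.

Lemma muni_var n (i : 'I_n) : muni ('X_(widen_ord (leqnSn n) i) : {mpoly K[n.+1]}) = ('X_i)%:P.
Proof.
rewrite muniE msuppX big_seq1 mcoeffX eqxx scale1r.
have -> : (U_(widen_ord (leqnSn n) i) : 'X_{1..n.+1})%MM ord_max = 0%N.
  by rewrite mnm1E -val_eqE /= ltn_eqF.
rewrite expr0 -mul_polyC mulr1; congr (_%:P); congr (mpolyX _ _).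
by apply/mnmP => j; rewrite mnmE !mnm1E -val_eqE.
Qed.

Lemma muni_ord_max n : muni ('X_ord_max : {mpoly K[n.+1]}) = 'X.
Proof.
rewrite muniE msuppX big_seq1 mcoeffX eqxx scale1r mnm1E eqxx expr1.
rewrite -[RHS]scale1r; congr (_ *: _); rewrite -mpolyX0; congr (mpolyX _ _).
by apply/mnmP => j; rewrite mnmE mnm1E mnm0E -val_eqE /= gtn_eqF.
Qed.

Lemma muni_mwiden n (p : {mpoly K[n]}) : muni (mwiden p) = p%:P.
Proof.
elim/mpolyind: p => [|c m p _ _ IHp]; first by rewrite !raddf0.
rewrite mwidenD muniD IHp polyCD; congr (_ + _).
rewrite mwidenZ muniZ -mul_mpolyC polyCM -mul_polyC; congr (_ * _).
rewrite mwidenX mpolyXE_id [in RHS]mpolyXE_id !rmorph_prod /=.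
rewrite big_ord_recr /= mnmwiden_ordmax expr0 rmorph1 mulr1.
by apply: eq_bigr => i _; rewrite !rmorphXn /= muni_var mnmwiden_widen.
Qed.

Definition of_muni n (p : {poly {mpoly K[n]}}) : {mpoly K[n.+1]} :=
  (map_poly (@mwiden n K) p).['X_ord_max].

Lemma of_muniK n : cancel (@of_muni n) (@muni n K).
Proof.
elim/poly_ind => [|p c IHp]; first by rewrite /of_muni rmorph0 horner0 muni0.
rewrite /of_muni rmorphD rmorphM /= map_polyX map_polyC hornerD hornerM hornerX hornerC.
by rewrite muniD muniM muni_mwiden muni_ord_max -/(of_muni p) IHp.
Qed.

Lemma muniK n : cancel (@muni n K) (@of_muni n).
Proof.
pose f := horner_eval ('X_ord_max : {mpoly K[n.+1]}) \o (map_poly (@mwiden n K) \o @muni n K).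
apply: (mpoly_rmorph_eq (f := f) (g := idfun)) => [c|i]; rewrite /f /= /horner_eval.
  by rewrite muniC map_polyC hornerC /= mwidenC.
case: (unliftP ord_max i) => [j ->|->].
  have -> : lift ord_max j = widen_ord (leqnSn n) j.
    by apply: val_inj; rewrite /= /bump leqNgt ltn_ord.
  by rewrite muni_var map_polyC hornerC /= mwidenX mnmwiden1.
by rewrite muni_ord_max map_polyX hornerX.
Qed.

Lemma factorial_mpoly n : factorial {mpoly K[n]}.
Proof.
elim: n => [|n IHn].
  move=> p p0; exists p, [::]; split=> //; last by rewrite big_nil mulr1.
  have ep := nvar0_mpolyC p.
  have c0 : p@_0 != 0 by apply: contra_not_neq p0 => c0; rewrite ep c0.
  by exists (p@_0)^-1%:MP; rewrite {1}ep -mpolyCM divff.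
exact: factorial_iso (@muniK n) (@of_muniK n) (factorial_poly IHn).
Qed.
End MPolyFactorial.

(** * Degree bounds for products and sums *)

Section MsizeBounds.
Variables (K : fieldType) (n : nat).
Implicit Types x y : {mpoly K[n]}.

(** [msize] is one more than the degree, so a product loses one of the two successors. *)
Lemma msizeM_leq x y d e :
  (msize x <= d.+1)%N -> (msize y <= e)%N -> (msize (x * y) <= d + e)%N.
Proof.
have [->|x0] := eqVneq x 0; first by rewrite mul0r msize0.
have [->|y0] := eqVneq y 0; first by rewrite mulr0 msize0.
move=> hx hy; rewrite msizeM // -subn1 leq_subLR addnA add1n.
exact: leq_add.
Qed.

Lemma msize_sum_bound (I : Type) (r : seq I) (P : pred I) (F : I -> {mpoly K[n]}) d :
  (forall i, P i -> (msize (F i) <= d)%N) -> (msize (\sum_(i <- r | P i) F i) <= d)%N.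
Proof.
move=> h; elim/big_ind: _ => //; first by rewrite msize0.
by move=> x y hx hy; apply: leq_trans (msizeD_le _ _) _; rewrite geq_max hx.
Qed.

End MsizeBounds.

(** * Points where a polynomial does not vanish *)

Section Points.
Variable K : closedFieldType.

(** For nonconstant [q], a root of [q - 1] serves. *)
Lemma closed_nonroot (q : {poly K}) : q != 0 -> exists x, q.[x] != 0.
Proof.
move=> q0; have [sq|sq] := leqP (size q) 1.
  by exists 0; rewrite [q]size1_polyC // hornerC; apply: contra_neq q0 => c0;
    rewrite [q]size1_polyC // c0.
have /closed_rootP[x rx] : size (q - 1) != 1%N.
  by rewrite size_polyDl ?size_polyN ?size_poly1 // gtn_eqF.
exists x; move: rx; rewrite rootE !hornerE subr_eq0 => /eqP ->.
exact: oner_neq0.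
Qed.

Lemma meval_muni n (p : {mpoly K[n.+1]}) (a : 'I_n.+1 -> K) :
  p.@[a] = (map_poly (meval (fun i => a (widen_ord (leqnSn n) i))) (muni p)).[a ord_max].
Proof.
pose g := horner_eval (a ord_max)
  \o (map_poly (meval (fun i => a (widen_ord (leqnSn n) i))) \o @muni n K).
apply: (mpoly_rmorph_eq (f := meval a) (g := g)) => [c|i].
  by rewrite /g /= /horner_eval muniC map_polyC hornerC /= !mevalC.
rewrite /g /= /horner_eval mevalXU; case: (unliftP ord_max i) => [j ->|->].
  have -> : lift ord_max j = widen_ord (leqnSn n) j.
    by apply: val_inj; rewrite /= /bump leqNgt ltn_ord.
  by rewrite muni_var /= map_polyC hornerC /= mevalXU.
by rewrite muni_ord_max /= map_polyX hornerX.
Qed.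

(** Induction on the variables: at a point where the leading coefficient in the last variable is
    nonzero, a nonzero univariate polynomial remains. *)
Lemma mpoly_nonroot n (p : {mpoly K[n]}) : p != 0 -> exists a, p.@[a] != 0.
Proof.
elim: n p => [|n IHn] p p0.
  exists (fun=> 0); rewrite [p]nvar0_mpolyC mevalC.
  by apply: contra_neq p0 => c0; rewrite [p]nvar0_mpolyC c0.
have m0 : lead_coef (muni p) != 0.
  rewrite lead_coef_eq0; apply: contra_neq p0 => m0.
  by apply: (can_inj (@muniK K n)); rewrite m0 muni0.
have [a ma] := IHn _ m0.
have f0 : map_poly (meval a) (muni p) != 0.
  apply: contra_neq ma => f0; have /polyP/(_ (size (muni p)).-1) := f0.
  by rewrite coef_map coef0.
have [x fx] := closed_nonroot f0.
pose b (i : 'I_n.+1) := if unlift ord_max i is Some j then a j else x.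
exists b; rewrite meval_muni.
have -> : b ord_max = x by rewrite /b unlift_none.
rewrite (_ : map_poly _ _ = map_poly (meval a) (muni p)) //.
apply: eq_map_poly => q; apply: meval_eq => i; rewrite /b.
have -> : widen_ord (leqnSn n) i = lift ord_max i.
  by apply: val_inj; rewrite /= /bump leqNgt ltn_ord.
by rewrite liftK.
Qed.

Lemma mpoly_eq0_points n (p : {mpoly K[n]}) : (forall a, p.@[a] = 0) -> p = 0.
Proof.
move=> h; apply/eqP; apply: contrapT => /negP/mpoly_nonroot[a].
by rewrite h eqxx.
Qed.
End Points.

(** * The weighted flow and the degrees it produces *)

Section Shift.
Variables (K : closedFieldType) (n : nat) (w : 'I_n -> nat) (c : 'I_n -> K).
Local Notation A := {mpoly K[n]}.

Definition shift_var (i : 'I_n) : {poly A} := ('X_i)%:P + (c i)%:MP *: 'X^(w i).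

(* Unlike a linear change of variables, this flow is compatible with the weights [w]:
   a form of weighted degree d becomes monic of degree d in the time variable ['X] as
   soon as it does not vanish at [c]. *)
Definition shift : A -> {poly A} := mmap (polyC \o @mpolyC n K) shift_var.
HB.instance Definition _ :=
  GRing.RMorphism.copy shift (mmap (polyC \o @mpolyC n K) shift_var).

Lemma shiftC x : shift x%:MP = x%:MP%:P.
Proof. by rewrite /shift mmapC. Qed.

Lemma shiftX i : shift 'X_i = shift_var i.
Proof. by rewrite /shift mmapX mmap1U. Qed.

Lemma meval_shift (p : A) (a : 'I_n -> K) x :
  (map_poly (meval a) (shift p)).[x] = p.@[fun i => a i + c i * x ^+ w i].
Proof.
pose f := horner_eval x \o (map_poly (meval a) \o shift).
apply: (mpoly_rmorph_eq (f := f) (g := meval _)) => [y|i]; rewrite /f /= /horner_eval.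
  by rewrite shiftC map_polyC hornerC /= !mevalC.
rewrite shiftX rmorphD /= map_polyC map_polyZ /= map_polyXn !hornerE /=.
by rewrite mevalC !mevalXU.
Qed.

Hypothesis w_gt0 : forall i, (0 < w i)%N.

Lemma shift0 (p : A) : (shift p).[0] = p.
Proof.
apply: (mpoly_rmorph_eq (f := horner_eval 0 \o shift) (g := idfun)) => [y|i] /=.
  by rewrite shiftC /horner_eval hornerC.
by rewrite shiftX /horner_eval !hornerE /= expr0n eqn0Ngt w_gt0 mulr0 addr0.
Qed.

(** [d] bounds the degree in time and [e] the degree of the coefficients in the remaining variables.
    The value [k] may be zero, which makes the bound stable under sums. *)
Definition shift_bound (d e : nat) (k : K) (F : {poly A}) :=
  [/\ (size F <= d.+1)%N, F`_d = k%:MP & forall i, (msize F`_i <= e.+1)%N].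

Lemma shift_bound1 : shift_bound 0 0 1 1.
Proof.
split; rewrite ?size_poly1 ?coef1 // => i; rewrite coef1.
by case: (i == 0)%N; rewrite ?msize1 ?msize0.
Qed.

Lemma shift_boundM d1 e1 k1 F1 d2 e2 k2 F2 :
  shift_bound d1 e1 k1 F1 -> shift_bound d2 e2 k2 F2 ->
  shift_bound (d1 + d2) (e1 + e2) (k1 * k2) (F1 * F2).
Proof.
move=> [s1 c1 m1] [s2 c2 m2]; split.
- by apply: leq_trans (size_polyMleq _ _) _; lia.
- have ltd : (d1 < (d1 + d2).+1)%N by lia.
  rewrite coefM (bigD1 (Ordinal ltd)) //= addKn c1 c2 -mpolyCM big1 ?addr0 //.
  move=> i; rewrite -val_eqE /= neq_ltn => /orP[lti|lti].
    by rewrite [F2`__]nth_default ?mulr0 // (leq_trans s2) //; lia.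
  by rewrite [F1`__]nth_default ?mul0r // (leq_trans s1).
- by move=> i; rewrite coefM; apply: msize_sum_bound => j _; rewrite -addnS; apply: msizeM_leq.
Qed.

Lemma shift_boundX d e k F m :
  shift_bound d e k F -> shift_bound (m * d) (m * e) (k ^+ m) (F ^+ m).
Proof.
move=> h; elim: m => [|m IHm]; first exact: shift_bound1.
by rewrite !exprS !mulSn; apply: shift_boundM.
Qed.

Lemma shift_var_bound i : shift_bound (w i) 1 (c i) (shift_var i).
Proof.
split.
- apply: leq_trans (size_polyD _ _) _; rewrite geq_max; apply/andP; split.
    by apply: leq_trans (size_polyC_leq1 _) _.
  by apply: leq_trans (size_scale_leq _ _) _; rewrite size_polyXn.
- rewrite coefD coefC coefZ coefXn eqxx mulr1.
  by rewrite eqn0Ngt w_gt0 add0r.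
- move=> j; rewrite coefD coefC coefZ coefXn; apply: leq_trans (msizeD_le _ _) _.
  rewrite geq_max; apply/andP; split.
    by case: (j == 0)%N; rewrite ?msizeX ?mdeg1 ?msize0.
  case: (j == w i); rewrite ?mulr1 ?mulr0 ?msize0 // msizeC.
  by case: (c i != 0).
Qed.

Definition wdeg (m : 'X_{1..n}) : nat := \sum_(i < n) m i * w i.

Lemma shiftXm m : shift_bound (wdeg m) (mdeg m) (\prod_(i < n) c i ^+ m i) (shift 'X_[m]).
Proof.
rewrite mpolyXE_id rmorph_prod /= mdegE /wdeg.
elim: (index_enum _) => [|i r IH]; first by rewrite !big_nil; apply: shift_bound1.
rewrite !big_cons rmorphXn /= shiftX; apply: shift_boundM IH.
by rewrite -{2}[m i]muln1; apply/shift_boundX/shift_var_bound.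
Qed.

Lemma shift_bound0 d e : shift_bound d e 0 0.
Proof. by split; rewrite ?size_poly0 ?coef0 // => i; rewrite coef0 msize0. Qed.

Lemma shift_boundD d e k1 F1 k2 F2 : shift_bound d e k1 F1 -> shift_bound d e k2 F2 ->
  shift_bound d e (k1 + k2) (F1 + F2).
Proof.
move=> [s1 c1 m1] [s2 c2 m2]; split.
- by apply: leq_trans (size_polyD _ _) _; rewrite geq_max s1.
- by rewrite coefD c1 c2 mpolyCD.
- by move=> i; rewrite coefD; apply: leq_trans (msizeD_le _ _) _; rewrite geq_max m1 /=.
Qed.

Lemma shift_boundZ d e k F x : shift_bound d e k F -> shift_bound d e (x * k) (x%:MP *: F).
Proof.
move=> [s1 c1 m1]; split; first exact: leq_trans (size_scale_leq _ _) s1.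
  by rewrite coefZ c1 mpolyCM.
by move=> i; rewrite coefZ mul_mpolyC; apply: leq_trans (msizeZ_le _ _) _.
Qed.

(** When [d] strictly increases, the coefficient read off lies beyond the degree in time, hence the
    value 0. *)
Lemma shift_bound_weaken d e k F d' e' : shift_bound d e k F ->
  (d <= d')%N -> (e <= e')%N -> shift_bound d' e' (if d == d' then k else 0) F.
Proof.
move=> [s1 c1 m1] dd ee; split; first exact: leq_trans s1 _.
  case: eqP => [<- //|/eqP ne]; rewrite mpolyC0 nth_default //.
  by rewrite (leq_trans s1) // ltn_neqAle ne.
by move=> i; apply: leq_trans (m1 i) _.
Qed.

Definition top_form d (p : A) : A :=
  \sum_(m <- msupp p | wdeg m == d) p@_m *: 'X_[m].

(** Monomials of weighted degree d contribute their value at [c] to the coefficient of degree d in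
    time; those of lower weight contribute nothing. *)
Lemma shift_bound_mpoly d (p : A) : (forall m, m \in msupp p -> (wdeg m <= d)%N) ->
  shift_bound d (msize p).-1 (top_form d p).@[c] (shift p).
Proof.
move=> hp; rewrite {3}[p]mpolyE rmorph_sum /top_form rmorph_sum /= big_mkcond /=.
have hm m : m \in msupp p -> (mdeg m <= (msize p).-1)%N.
  by move=> /msize_mdeg_lt; case: (msize p).
elim: (msupp p) hp hm => [|m s IHs] hp hm.
  by rewrite !big_nil; apply: shift_bound0.
rewrite !big_cons; apply: shift_boundD; last first.
  by apply: IHs => m' ms; [apply: hp | apply: hm]; rewrite inE ms orbT.
rewrite -mul_mpolyC [shift _]rmorphM /= shiftC mul_polyC.
have -> : (if wdeg m == d then ((p@_m)%:MP * 'X_[m]).@[c] else 0) =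
    p@_m * (if wdeg m == d then \prod_(i < n) c i ^+ m i else 0).
  by case: ifP => _; rewrite ?mulr0 // mevalM mevalC mevalX.
apply/shift_boundZ/shift_bound_weaken; first exact: shiftXm.
  by apply: hp; rewrite inE eqxx.
by apply: hm; rewrite inE eqxx.
Qed.
End Shift.

Section ShiftInverse.
Variables (K : closedFieldType) (n : nat) (w : 'I_n -> nat) (c : 'I_n -> K).

(** The increment of each variable depends on time only, so flowing with [- c] for the same time
    cancels it. *)
Lemma shiftK (p : {mpoly K[n]}) :
  (map_poly (shift w (fun i => - c i)) (shift w c p)).['X] = p%:P.
Proof.
pose f := horner_eval 'X \o (map_poly (shift w (fun i => - c i)) \o shift w c).
apply: (mpoly_rmorph_eq (f := f) (g := polyC)) => [y|i]; rewrite /f /= /horner_eval.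
  by rewrite shiftC map_polyC hornerC /= shiftC.
rewrite shiftX rmorphD /= map_polyC map_polyZ /= map_polyXn !hornerE /=.
rewrite shiftX shiftC /shift_var mpolyCN scaleNr -addrA -mul_polyC.
by rewrite addNr addr0.
Qed.
End ShiftInverse.

(** * Discriminants in characteristic 0 *)

Section Discriminant.
Variables (K : closedFieldType) (charK : [pchar K] =i pred0) (n : nat).
Local Notation A := {mpoly K[n]}.
Implicit Types (F G : {poly A}) (p : A).

(** For F of positive degree this is the classical discriminant up to sign and a factor of the
    leading coefficient. *)
Definition disc F : A := resultant F F^`().

Lemma msize_det_bound m (M : 'M[A]_m) e :
  (forall i j, (msize (M i j) <= e.+1)%N) -> (msize (\det M) <= (m * e).+1)%N.
Proof.
move=> hM; apply: msize_sum_bound => s _.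
have hs : (msize ((-1) ^+ s : A) <= 1)%N.
  by case: (s : bool); rewrite ?expr1 ?expr0 ?msizeN msize1.
have -> : (m * e)%N = (\sum_(i < m) e)%N by rewrite sum_nat_const card_ord.
apply: (msizeM_leq (d := 0)) => //=.
elim/big_rec2: _ => [|i d x _]; first by rewrite msize1.
by rewrite -addnS; apply: msizeM_leq; apply: hM.
Qed.

(** The Sylvester matrix of F and its derivative has at most [d.-1 + d] rows, and each entry is zero
    or a coefficient of degree at most e. *)
Lemma msize_disc_bound F d e : size F = d.+1 ->
  (forall i, (msize F`_i <= e.+1)%N) -> (msize (disc F) <= ((d.-1 + d) * e).+1)%N.
Proof.
move=> sF hF; have h' i : (msize F^`()`_i <= e.+1)%N.
  by rewrite coef_deriv -scaler_nat; apply: leq_trans (msizeZ_le _ _) _.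
apply: leq_trans (msize_det_bound (e := e) _) _ => [i j|].
  rewrite Sylvester_mxE; case: (split i) => k /=; case: (k <= j)%N;
    by rewrite ?mulr0n ?mulr1n ?msize0.
rewrite ltnS leq_mul2r sF /= leq_add2r.
apply/orP; right; case: d sF => [|d] sF.
  by rewrite [F]size1_polyC ?sF // derivC size_poly0.
have F0 : F != 0 by rewrite -size_poly_gt0 sF.
by have := lt_size_deriv F0; rewrite sF /=; case: (size _).
Qed.

Lemma mpoly_mulrSn_eq0 p k : (p *+ k.+1 == 0) = (p == 0).
Proof.
have k0 : k.+1%:R != 0 :> K by rewrite ((pcharf0P K).1 charK).
by rewrite -scaler_nat scaler_eq0 (negbTE k0).
Qed.

Lemma size_deriv_char0 F : size F^`() = (size F).-1.
Proof.
have [->|F0] := eqVneq F 0; first by rewrite deriv0 size_poly0.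
have sF := polySpred F0; apply/eqP; rewrite eqn_leq.
rewrite -ltnS -sF lt_size_deriv //=; rewrite sF /=.
case sF' : (size F) sF => [|[|k]] _ //=; rewrite ltnNge; apply/negP => /leq_sizeP/(_ k (leqnn _)).
rewrite coef_deriv => /eqP; rewrite mpoly_mulrSn_eq0 => /eqP Fk.
by move: F0; rewrite -lead_coef_eq0 /lead_coef sF' /= Fk eqxx.
Qed.

(* The gcd with the derivative has a prime factor of positive degree since A[t] is
   factorial; in characteristic 0 it divides [F] twice. *)
Lemma disc_eq0 F : (1 < size F)%N -> disc F = 0 ->
  exists2 G : {poly A}, (1 < size G)%N & divides (G * G) F.
Proof.
move=> sF /eqP; rewrite resultant_eq0; set G := gcdp _ _ => sG.
have fA : factorial {poly A} by apply/factorial_poly/factorial_mpoly.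
have [q pq [sq qG]] : exists2 q : {poly A}, prime_elt q & (1 < size q)%N /\ divides q G.
  have G0 : G <> 0 by move=> G0; move: sG; rewrite G0 size_poly0.
  have [u [s [uu sp e]]] := fA _ G0.
  apply: contrapT => h; suff : (size G <= 1)%N by rewrite leqNgt sG.
  rewrite e; apply: leq_trans (size_polyMleq _ _) _.
  rewrite (is_unit_size uu) add1n /=.
  have {}h (p : {poly A}) : p \in s -> (size p <= 1)%N.
    move=> ps; rewrite leqNgt; apply/negP => sp1; apply: h; exists p; first exact: sp.
    split=> //; rewrite e (big_rem p) //= mulrCA; exact: divides_mulr.
  elim: s h {sp e} => [|p s IHs] h; first by rewrite big_nil size_poly1.
  rewrite big_cons; apply: leq_trans (size_polyMleq _ _) _.
  have hp := h p (mem_head _ _); have {}IHs : (size (\prod_(q <- s) q)%R <= 1)%N.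
    by apply: IHs => q qs; apply: h; rewrite inE qs orbT.
  by rewrite -subn1 leq_subLR (leq_add hp IHs).
have [_ _ qP] := pq.
have small (H : {poly A}) : (size H < size q)%N -> divides q H -> H = 0.
  move=> sH [k ek]; apply/eqP; apply: contraTT sH => H0; rewrite -leqNgt ek.
  move: H0; rewrite ek mulf_eq0 negb_or => /andP[q0 k0].
  by rewrite size_mul // -subn1 -addnBA ?leq_addr // size_poly_gt0.
(* The gcd divides [H] only up to a nonzero constant [a]; the prime [q] has positive degree and
   cannot divide [a]. *)
have qdiv (H : {poly A}) : G %| H -> divides q H.
  move=> /Pdiv.Idomain.dvdpP[[a k] /= a0 e].
  case: (qP a%:P H); last by [].
    by rewrite mul_polyC e; apply: divides_trans qG (divides_mull _ _).
  move/small; rewrite size_polyC a0 => /(_ sq) /polyC_inj ea.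
  by rewrite ea eqxx in a0.
have [k ek] : divides q F by apply: qdiv; apply: dvdp_gcdl.
have qF' : divides q F^`() by apply: qdiv; apply: dvdp_gcdr.
exists q => //; suff [l el] : divides q k by exists l; rewrite ek el mulrA.
(* From F = q k, the product rule leaves q' k modulo q, and q' is nonzero of smaller degree than q,
   so q divides k. *)
have : divides q (q^`() * k).
  have -> : q^`() * k = F^`() - q * k^`() by rewrite ek derivM addrK.
  by apply: dividesB => //; apply: divides_mulr.
case/qP => // /small; rewrite size_deriv_char0 prednK ?(ltnW sq) // leqnn => /(_ isT) q'0.
by have := size_deriv_char0 q; rewrite q'0 size_poly0; case: (size q) sq => [|[|?]].
Qed.

(** At [a] the polynomial F keeps its degree d + 1 and has d + 1 distinct roots. The specialization
    of [v] has degree at most d and vanishes at all of them. *)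
Lemma root_eq0_of_disc F d k (a : 'I_n -> K) (v : {poly A}) :
  size F = d.+2 -> F`_d.+1 = k%:MP -> k != 0 -> (disc F).@[a] != 0 ->
  (size v <= d.+1)%N ->
  (forall x, root (map_poly (meval a) F) x -> root (map_poly (meval a) v) x) ->
  forall i, (v`_i).@[a] = 0.
Proof.
move=> sF lF k0 D0 sv hv.
set f := map_poly (meval a) F in hv *.
have fd : f`_d.+1 = k by rewrite coef_map /= lF mevalC.
have sf : size f = d.+2.
  apply/eqP; rewrite eqn_leq -{1}sF size_poly /=.
  by rewrite ltnNge; apply/negP => /leq_sizeP/(_ d.+1 (leqnn _))/eqP; rewrite fd (negbTE k0).
have [r er] := closed_field_poly_normal f.
have lf0 : lead_coef f != 0 by rewrite lead_coef_eq0 -size_poly_gt0 sf.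
have sr : size r = d.+1.
  by apply: succn_inj; rewrite -sf er size_scale // size_prod_XsubC.
have ur : uniq r.
  (* A linear polynomial is treated apart: the Bezout relation for the resultant below requires a
     nonconstant derivative. *)
  case: (posnP d) => [d0|d0]; first by move: sr; rewrite d0; case: (r) => [|x [|]].
  have sF1 : (1 < size F)%N by rewrite sF.
  have sF2 : (1 < size F^`())%N by rewrite size_deriv_char0 sF.
  have [[U V] _ /= e] := resultant_in_ideal sF1 sF2.
  (* Specialized at [a], the Bezout relation has a nonzero scalar on the left, so [f] is coprime to
     its derivative. *)
  rewrite -separable_prod_XsubC separable_poly.unlock; suff : coprimep f f^`().
    by rewrite {1 2}er derivZ coprimepZl // coprimepZr.
  apply/Bezout_coprimepP; exists (map_poly (meval a) U, map_poly (meval a) V).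
  rewrite /= /f deriv_map -!rmorphM -rmorphD -e /= map_polyC /=.
  by rewrite polyC_eqp1.
have g0 : map_poly (meval a) v = 0.
  apply/eqP; apply: contraTT sv => g0; rewrite -ltnNge.
  apply: leq_trans (size_poly _ _ : (size (map_poly (meval a) v) <= _)%N).
  rewrite -sr; apply: max_poly_roots => //; apply/allP => x xr; apply: hv.
  by rewrite er rootZ // root_prod_XsubC.
by move=> i; rewrite -coef_map g0 coef0.
Qed.
End Discriminant.

Lemma poly_rmorph_id (R : nzRingType) (f : {rmorphism {poly R} -> {poly R}}) :
  (forall c, f c%:P = c%:P) -> f 'X = 'X -> f =1 id.
Proof.
move=> fC fX; elim/poly_ind => [|F c IHF]; first by rewrite rmorph0.
by rewrite rmorphD rmorphM fC fX IHF.
Qed.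

Section ShiftPoly.
Variables (K : closedFieldType) (n : nat) (w : 'I_n -> nat).
Local Notation A := {mpoly K[n]}.

(** The flow extended to [{poly A}] by fixing time. It is an automorphism, which lets factorizations
    of [shift w c p] be carried back to [p]. *)
Definition shift_poly (c : 'I_n -> K) : {poly A} -> {poly A} :=
  horner_eval 'X \o map_poly (shift w c).
HB.instance Definition _ c := GRing.RMorphism.copy (shift_poly c)
  (horner_eval 'X \o map_poly (shift w c)).

Lemma shift_polyC c p : shift_poly c p%:P = shift w c p.
Proof. by rewrite /shift_poly /= /horner_eval map_polyC hornerC. Qed.

Lemma shift_polyX c : shift_poly c 'X = 'X.
Proof. by rewrite /shift_poly /= /horner_eval map_polyX hornerX. Qed.

Lemma shift_poly_shift c p : shift_poly (fun i => - c i) (shift w c p) = p%:P.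
Proof. exact: shiftK. Qed.

Lemma shift_polyK c : cancel (shift_poly c) (shift_poly (fun i => - c i)).
Proof.
apply: (poly_rmorph_id (f := shift_poly (fun i => - c i) \o shift_poly c)) => [p|].
  transitivity (shift_poly (fun i => - c i) (shift w c p)); last exact: shift_poly_shift.
  exact: congr1 (shift_polyC c p).
transitivity (shift_poly (fun i => - c i) 'X); last exact: shift_polyX.
exact: congr1 (shift_polyX c).
Qed.

Lemma shift_polyNK c : cancel (shift_poly (fun i => - c i)) (shift_poly c).
Proof.
have {2}-> : c = (fun i => - - c i) by apply/funext => i; rewrite opprK.
exact: shift_polyK.
Qed.
End ShiftPoly.

(** * Nullstellensatz for one and for two equations *)

Section Nullstellensatz.
Variables (K : closedFieldType) (charK : [pchar K] =i pred0) (n : nat).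
Local Notation A := {mpoly K[n]}.
Implicit Types (p q h : A).

Lemma square_free_neq0 p : square_free p -> p != 0.
Proof.
move=> sp; apply/eqP => p0; have [|x] := sp 0.
  by rewrite p0; apply: divides0.
by rewrite mul0r => /eqP; rewrite eq_sym oner_eq0.
Qed.

(** A zero discriminant gives a square factor of the flow of p. Flowing back makes it a square
    factor of p itself, constant in time, hence a unit. *)
Lemma disc_shift_neq0 w c p : square_free p -> (1 < size (shift w c p))%N ->
  disc (shift w c p) != 0.
Proof.
move=> sp sF; apply/eqP => /(disc_eq0 charK sF)[G sG [k ek]].
have [G1 [k1 [ep eG]]] : exists G1 k1 : {poly A},
    p%:P = G1 * G1 * k1 /\ shift_poly w c G1 = G.
  exists (shift_poly w (fun i => - c i) G), (shift_poly w (fun i => - c i) k).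
  split; last exact: shift_polyNK.
  by rewrite -!rmorphM -ek; apply/esym/shift_poly_shift.
have p0 := square_free_neq0 sp.
have : p%:P != 0 :> {poly A} by rewrite polyC_eq0.
rewrite ep !mulf_eq0 !negb_or => /andP[/andP[G0 _] k0].
have := size_polyC p; rewrite ep p0 !size_mul ?mulf_neq0 //.
have sG0 : (0 < size G1)%N by rewrite size_poly_gt0.
have sk0 : (0 < size k1)%N by rewrite size_poly_gt0.
move=> sz; have sfG : (size G1 <= 1)%N.
  by move: sz sG0 sk0; case: (size G1) => [|[|a]] //; case: (size k1) => [|b] //;
    rewrite !addSn !addnS.
have sfk : (size k1 <= 1)%N.
  by move: sz sG0 sk0; case: (size G1) => [|[|a]] //; case: (size k1) => [|[|b]] //;
    rewrite !addSn !addnS.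
have [x ex] : is_unit G1.
  rewrite (size1_polyC sfG); apply/is_unitC/sp; exists k1`_0; apply: polyC_inj.
  by rewrite !polyCM -!size1_polyC.
have /is_unit_size sG1 : is_unit G.
  by exists (shift_poly w c x); rewrite -eG -rmorphM ex; apply: rmorph1.
by rewrite sG1 in sG.
Qed.

Lemma mcoeff_top_form w d p m :
  (top_form w d p)@_m = if wdeg w m == d then p@_m else 0.
Proof.
rewrite /top_form raddf_sum /= big_mkcond /=.
have [mp|mp] := boolP (m \in msupp p); last first.
  rewrite (memN_msupp_eq0 mp) if_same big_seq big1 // => m' m'p; case: ifP => // _.
  rewrite mcoeffZ mcoeffX; case: eqP => [e|]; last by rewrite mulr0.
  by rewrite -e m'p in mp.
rewrite (bigD1_seq m) //= big1 ?addr0; last first.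
  by move=> m' ne; case: ifP => // _; rewrite mcoeffZ mcoeffX (negbTE ne) mulr0.
by case: ifP => // _; rewrite mcoeffZ mcoeffX eqxx mulr1.
Qed.

Lemma wdeg1 (m : 'X_{1..n}) : wdeg (fun=> 1%N) m = mdeg m.
Proof. by rewrite mdegE; apply: eq_bigr => i _; rewrite muln1. Qed.

(** Noether normalization: with all weights 1, [c] is a point where the form of highest degree of q
    does not vanish. *)
Lemma linear_shift_bound q : q != 0 -> exists (c : 'I_n -> K) k,
  k != 0 /\ shift_bound (msize q).-1 (msize q).-1 k (shift (fun=> 1%N) c q).
Proof.
move=> q0; have t0 : top_form (fun=> 1%N) (msize q).-1 q != 0.
  apply/eqP => /mpolyP/(_ (mlead q)); rewrite mcoeff_top_form wdeg1 mcoeff0.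
  by rewrite -(mlead_deg q0) eqxx => /eqP; rewrite mleadc_eq0 (negbTE q0).
have [c c0] := mpoly_nonroot t0; exists c, (top_form (fun=> 1%N) (msize q).-1 q).@[c].
split=> //; apply: shift_bound_mpoly => // m /msize_mdeg_lt.
by rewrite wdeg1; case: (msize q).
Qed.

Lemma shift_bound_size d e k (F : {poly A}) :
  shift_bound d e k F -> k != 0 -> size F = d.+1.
Proof.
move=> [s f _] k0; apply/eqP; rewrite eqn_leq s ltnNge; apply/negP => /leq_sizeP/(_ d (leqnn _)).
by rewrite f => /eqP; rewrite mpolyC_eq0 (negbTE k0).
Qed.

(** After normalization a nonconstant q restricts to a nonconstant polynomial on a line, and so has
    a root there. *)
Lemma nowhere_zero_unit q : (forall a, q.@[a] != 0) -> is_unit q.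
Proof.
move=> hq; have q0 : q != 0 by apply: contra_neq (hq (fun=> 0)) => ->; rewrite meval0.
have [c [k [k0 b]]] := linear_shift_bound q0.
case e : (msize q).-1 b => [|d] b.
  have qC : q = (q@_0)%:MP by apply: msize1_polyC; rewrite -e; case: (msize q).
  exists (q@_0)^-1%:MP; rewrite {1}qC -mpolyCM divff //.
  by apply: contra_neq q0 => h; rewrite qC h.
have sF := shift_bound_size b k0; have [_ lF _] := b.
have /closed_rootP[x] : size (map_poly (meval (fun=> 0)) (shift (fun=> 1%N) c q)) != 1%N.
  rewrite gtn_eqF // ltnNge; apply/negP => /leq_sizeP/(_ d.+1 isT)/eqP.
  by rewrite coef_map /= lF mevalC (negbTE k0).
by rewrite rootE meval_shift (negbTE (hq _)).
Qed.

(** Off the discriminant the remainder of h by the flow of p has too many roots; the factor [disc]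
    covers the other points. Only zeros of p on the flow curve through [a] are tested, so the result
    can be used on a flow-invariant subset. *)
Lemma shift_reduction w c p h d e k : shift_bound d.+1 e k (shift w c p) -> k != 0 ->
  exists u v : {poly A}, shift w c h = u * shift w c p + v /\
    forall a : 'I_n -> K, (forall b, p.@[b] = 0 -> (exists x, b = fun i => a i + c i * x ^+ w i) ->
       h.@[b] = 0) ->
    forall i, (disc (shift w c p) * v`_i).@[a] = 0.
Proof.
move=> b k0; set F := shift w c p; have sF := shift_bound_size b k0.
have [_ lF _] := b.
have uF : lead_coef F \is a GRing.unit.
  rewrite /lead_coef sF /= lF; apply/unitrP; exists k^-1%:MP.
  by rewrite -!mpolyCM mulVf // mulfV.
exists (shift w c h %/ F), (shift w c h %% F).
split; first exact: Pdiv.IdomainUnit.divp_eq.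
move=> a ha i; rewrite mevalM.
have [->|D0] := eqVneq (disc F).@[a] 0; first by rewrite mul0r.
rewrite (root_eq0_of_disc charK sF lF k0 D0) ?mulr0 //.
  by rewrite -ltnS -sF ltn_modp -size_poly_gt0 sF.
move=> x; rewrite !rootE meval_shift => /eqP px.
have := congr1 (fun G => (map_poly (meval a) G).[x]) (Pdiv.IdomainUnit.divp_eq uF (shift w c h)).
rewrite /= meval_shift ha //; last by exists x.
by rewrite rmorphD rmorphM hornerD hornerM meval_shift px mulr0 add0r => <-.
Qed.

(* Divide [h] by [q] along the flow: at every point off the discriminant the remainder
   has more roots than its degree, so all its coefficients vanish identically. *)
Lemma hypersurface_nullstellensatz q h : square_free q ->
  (forall a, q.@[a] = 0 -> h.@[a] = 0) -> divides q h.
Proof.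
move=> sq hq; have q0 := square_free_neq0 sq.
have [c [k [k0 b]]] := linear_shift_bound q0.
case e : (msize q).-1 b => [|d] b.
  apply: unit_divides; have qC : q = (q@_0)%:MP.
    by apply: msize1_polyC; rewrite -e; case: (msize q).
  exists (q@_0)^-1%:MP; rewrite {1}qC -mpolyCM divff //.
  by apply: contra_neq q0 => h0; rewrite qC h0.
have sF := shift_bound_size b k0.
have D0 : disc (shift (fun=> 1%N) c q) != 0 by apply: disc_shift_neq0; rewrite ?sF.
have [u [v [euv hv]]] := shift_reduction h b k0.
have v0 : v = 0.
  apply/polyP => i; rewrite coef0; apply: (@mulfI _ (disc (shift (fun=> 1%N) c q))) => //.
  rewrite mulr0; apply: mpoly_eq0_points => a; apply: hv => b' qb' _; exact: hq.
exists u.[0]; have sh x : (shift (fun=> 1%N) c x).[0] = x by apply: shift0.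
move: (sh h) (sh q) euv; move: (shift _ c h) (shift _ c q) => Fh Fq <- eq ->.
by rewrite v0 addr0 hornerM eq mulrC.
Qed.

(** As q is constant along the flow, curves starting on V(q) stay there, so [disc] times each
    coefficient of the remainder vanishes on V(q). Coprimality then lets q divide the coefficients
    themselves. *)
Lemma pair_nullstellensatz w c p q h d e k :
  (forall i, (0 < w i)%N) -> shift_bound d.+1 e k (shift w c p) -> k != 0 ->
  shift w c q = q%:P -> square_free q ->
  (forall r, prime_elt r -> divides r q -> ~ divides r (disc (shift w c p))) ->
  (forall a, p.@[a] = 0 -> q.@[a] = 0 -> h.@[a] = 0) ->
  exists u v, h = u * p + v * q.
Proof.
move=> w0 b k0 qc sq cop hpq.
have [u [v [euv hv]]] := shift_reduction h b k0.
have /dividesCP[v' ev'] : forall i, divides q v`_i.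
  have q0 : q <> 0 by apply/eqP/square_free_neq0.
  move=> i; apply: (factorial_coprime_divides (@factorial_mpoly K n) q0 cop).
  apply: hypersurface_nullstellensatz => // a qa; apply: hv => b' pb' [x ex].
  by apply: hpq => //; rewrite ex -meval_shift qc map_polyC hornerC.
(* At time 0 the division along the flow becomes the required identity. *)
exists u.[0], v'.[0]; have sh x : (shift w c x).[0] = x by apply: shift0.
move: (sh h) (sh p) euv; move: (shift w c h) (shift w c p) => Fh Fp <- ep ->.
by rewrite hornerD ev' !hornerM hornerC ep [q * _]mulrC.
Qed.

(** A prime has positive degree, so dividing [D] by one lowers its degree; the other primes still
    divide the quotient. *)
Lemma count_prime_divisors (T : eqType) (s : seq T) (r : T -> A) (D : A) :
  D != 0 -> uniq s -> (forall i, i \in s -> prime_elt (r i)) ->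
  (forall i, i \in s -> divides (r i) D) ->
  (forall i j, i \in s -> j \in s -> i <> j -> ~ divides (r i) (r j)) ->
  (size s < msize D)%N.
Proof.
elim: s D => [|i s IHs] D D0 /=.
  by move=> *; rewrite lt0n msize_poly_eq0.
move=> /andP[ni us] pr dv nd.
have is1 j : j \in s -> j \in i :: s by move=> js; rewrite inE js orbT.
have [D' eD] := dv i (mem_head _ _).
have [r0 nu _] := pr i (mem_head _ _).
have D'0 : D' != 0 by apply: contra_neq D0 => h; rewrite eD h mulr0.
have sr : (1 < msize (r i))%N.
  rewrite ltnNge; apply/negP => /msize1_polyC rC; apply: nu.
  exists ((r i)@_0)^-1%:MP; rewrite {1}rC -mpolyCM divff //.
  by apply/eqP => h; apply: r0; rewrite rC h.
have sD' : (size s < msize D')%N.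
  apply: IHs => // [j js|j js|j k js ks]; [exact/pr/is1| |by apply: nd; exact: is1].
  have [_ _ pP] := pr j (is1 j js); have := dv j (is1 j js); rewrite eD => /pP[] // dji.
  case: (nd j i) => //; [exact: is1 | exact: mem_head |].
  by move=> e; rewrite -e js in ni.
rewrite eD msizeM //; last exact/eqP.
by case: (msize (r i)) sr => [|[|a]] // _; rewrite !addSn /= ltnS (leq_trans sD') ?leq_addl.
Qed.
End Nullstellensatz.

(** * Homogeneous components and degrees *)

Section Components.
Variables (K : fieldType) (N : nat).
Local Notation S := {mpoly K[N]}.
Local Notation comp := (pihomog mdeg).
Implicit Types x y : S.

Lemma comp_small e x : (msize x <= e)%N -> comp e x = 0.
Proof.
move=> hx; rewrite pihomogE big_seq_cond big1 // => m /andP[mx /eqP em].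
by have := msize_mdeg_lt mx; rewrite em ltnNge hx.
Qed.

Lemma msize_comp e x : (msize (comp e x) <= e.+1)%N.
Proof.
have /dhomogP h := pihomogP mdeg e x; rewrite msizeE.
by apply/bigmax_leqP_seq => m /h /= ->.
Qed.

Lemma msize_homog e x : x \is e.-homog -> (msize x <= e.+1)%N.
Proof. by move/pihomog_dE <-; apply: msize_comp. Qed.

Lemma msize_sub_comp e x : (msize x <= e.+1)%N -> (msize (x - comp e x) <= e)%N.
Proof.
move=> hx; rewrite {1}[x](pihomog_partitionE hx) big_ord_recr /= addrK.
apply: leq_trans (msize_sum _ _ _) _; apply/bigmax_leqP => i _.
exact: leq_trans (msize_comp _ _) (ltn_ord i).
Qed.

(** The cross terms with [x - comp d x] and [y - comp e y] have degree below d + e. *)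
Lemma comp_topM d e x y : (msize x <= d.+1)%N -> (msize y <= e.+1)%N ->
  comp (d + e) (x * y) = comp d x * comp e y.
Proof.
move=> hx hy; have -> : x * y = comp d x * comp e y + (comp d x * (y - comp e y)
    + y * (x - comp d x)) by ring.
rewrite raddfD /= pihomog_dE; last by apply: dhomogM; apply: pihomogP.
rewrite [comp _ (_ + _)]comp_small ?addr0 //.
apply: leq_trans (msizeD_le _ _) _; rewrite geq_max; apply/andP; split.
  by apply: msizeM_leq (msize_comp _ _) (msize_sub_comp _).
by rewrite addnC; apply: msizeM_leq hy (msize_sub_comp _).
Qed.

Lemma comp_mul_homog d e x y : y \is e.-homog -> comp (d + e) (x * y) = comp d x * y.
Proof.
move=> hy; rewrite {1}[x](pihomog_partitionE (leqnn (msize x))) mulr_suml raddf_sum /=.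
have hc i : comp (d + e) (comp i x * y) = if i == d then comp d x * y else 0.
  have h : comp i x * y \is (i + e).-homog by apply: dhomogM => //; apply: pihomogP.
  case: eqP => [<-|/eqP ne]; first exact: pihomog_dE h.
  by apply: pihomog_ne0 h; rewrite eqn_add2r.
rewrite (eq_bigr _ (fun (i : 'I_(msize x)) _ => hc i)) -big_mkcond /=.
have [ld|gd] := ltnP d (msize x); first by rewrite (big_pred1 (Ordinal ld)).
by rewrite comp_small // mul0r big1.
Qed.

Lemma comp_mul_homog_small d e x y : y \is e.-homog -> (d < e)%N -> comp d (x * y) = 0.
Proof.
move=> hy de; rewrite {1}[x](pihomog_partitionE (leqnn (msize x))) mulr_suml raddf_sum /=.
apply: big1 => i _.
have h : comp i x * y \is (i + e).-homog by apply: dhomogM => //; apply: pihomogP.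
by apply: pihomog_ne0 h; rewrite gtn_eqF // ltn_addl.
Qed.

Lemma comp_mul_homog_sub d e x y : y \is e.-homog -> 
  comp d (x * y) = (if (e <= d)%N then comp (d - e) x else 0) * y.
Proof.
move=> hy; case: leqP => [ed|de]; last by rewrite mul0r (comp_mul_homog_small _ hy).
by rewrite -(comp_mul_homog _ _ hy) subnK.
Qed.
Lemma comp_sum d (I : Type) (r : seq I) (P : pred I) (F : I -> S) :
  comp d (\sum_(i <- r | P i) F i) = \sum_(i <- r | P i) comp d (F i).
Proof. exact: raddf_sum. Qed.
End Components.

(** * Ideals generated by part of a sequence, and radicals *)

Section Ideals.
Variable A : comPzRingType.
Implicit Types (I : ideal A) (x y : A).

Lemma idealN I x : I x -> I (- x).
Proof. by move=> hx; rewrite -mulN1r; apply: ideal_mul. Qed.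

Lemma idealB I x y : I x -> I y -> I (x - y).
Proof. by move=> hx hy; apply: ideal_add => //; apply: idealN. Qed.

Lemma idealMr I x y : I x -> I (x * y).
Proof. by rewrite mulrC; apply: ideal_mul. Qed.

Lemma ideal_sum I (T : Type) (r : seq T) (P : pred T) (F : T -> A) :
  (forall i, P i -> I (F i)) -> I (\sum_(i <- r | P i) F i).
Proof. by move=> h; elim/big_ind: _ => //; [apply: ideal_zero | apply: ideal_add]. Qed.

Lemma ideal_congr I x y : I (x - y) -> I x -> I y.
Proof. by move=> hxy hx; rewrite -[y](subKr x); apply: idealB. Qed.

Lemma ideal_prod_congr I (T : Type) (r : seq T) (F G : T -> A) :
  (forall i, I (F i - G i)) -> I (\prod_(i <- r) F i - \prod_(i <- r) G i).
Proof.
move=> h; elim/big_rec2: _ => [|i x y _ hxy]; first by rewrite subrr; apply: ideal_zero.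
have -> : F i * y - G i * x = F i * (y - x) + x * (F i - G i) by ring.
by apply: ideal_add; apply: ideal_mul.
Qed.

Lemma ideal_exp_congr I x y m : I (x - y) -> I (x ^+ m - y ^+ m).
Proof.
move=> h; elim: m => [|m IHm]; first by rewrite subrr; apply: ideal_zero.
have -> : x ^+ m.+1 - y ^+ m.+1 = x * (x ^+ m - y ^+ m) + y ^+ m * (x - y).
  by rewrite !exprS; ring.
by apply: ideal_add; apply: ideal_mul.
Qed.

(** The exponent is repeatedly halved, rounding up, until it reaches 1. *)
Lemma ideal_radical_of_square I : (forall x, I (x * x) -> I x) ->
  forall x m, I (x ^+ m.+1) -> I x.
Proof.
move=> hI x m; have [k] := ubnP m; elim: k m => // k IHk [|m] mk; first by rewrite expr1.
move=> h; have := odd_double_half m.+1; set j := (m.+1)./2; rewrite -addnn => ej.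
apply: (IHk j); first by move: mk; lia.
apply: hI; rewrite -exprD.
have -> : (j.+1 + j.+1 = m.+2 + (j.+1 + j.+1 - m.+2))%N.
  by rewrite subnKC //; case: (odd _) ej; lia.
by rewrite exprD; apply: idealMr.
Qed.
End Ideals.

Section Cut.
Variables (A : comPzRingType) (I : ideal A) (n : nat) (t : 'I_n -> A) (k : nat).

(** This is the preimage in [A] of the ideal generated by the first k members of [t] in the quotient
    by [I]. Staying in [A] keeps polynomial degrees available. *)
Definition cut_set : set A :=
  [set y | exists u : 'I_n -> A, I (y - \sum_(i < n | (i < k)%N) u i * t i)].

Fact cut_zero : cut_set 0.
Proof.
exists (fun=> 0); rewrite big1 ?subr0; first exact: ideal_zero.
by move=> i _; rewrite mul0r.
Qed.

Fact cut_add x y : cut_set x -> cut_set y -> cut_set (x + y).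
Proof.
move=> [u hu] [v hv]; exists (fun i => u i + v i).
have -> : \sum_(i < n | (i < k)%N) (u i + v i) * t i =
  \sum_(i < n | (i < k)%N) u i * t i + \sum_(i < n | (i < k)%N) v i * t i.
  by rewrite -big_split; apply: eq_bigr => i _; rewrite mulrDl.
by rewrite opprD addrACA; apply: ideal_add.
Qed.

Fact cut_mul a x : cut_set x -> cut_set (a * x).
Proof.
move=> [u hu]; exists (fun i => a * u i).
have -> : \sum_(i < n | (i < k)%N) a * u i * t i = a * \sum_(i < n | (i < k)%N) u i * t i.
  by rewrite mulr_sumr; apply: eq_bigr => i _; rewrite mulrA.
by rewrite -mulrBr; apply: ideal_mul.
Qed.

Definition cut_ideal : ideal A := Ideal cut_zero cut_add cut_mul.

Lemma cut_sub x : I x -> cut_ideal x.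
Proof.
move=> hx; exists (fun=> 0); rewrite big1 ?subr0 // => i _; exact: mul0r.
Qed.

Lemma cut_sum (u : 'I_n -> A) : cut_ideal (\sum_(i < n | (i < k)%N) u i * t i).
Proof. by exists u; rewrite subrr; apply: ideal_zero. Qed.

Lemma cut_gen (i : 'I_n) : (i < k)%N -> cut_ideal (t i).
Proof.
move=> ik; exists (fun j => if j == i then 1 else 0).
rewrite (bigD1 i) //= eqxx mul1r big1 ?addr0 ?subrr; first exact: ideal_zero.
by move=> j /andP[_ /negbTE ->]; rewrite mul0r.
Qed.
End Cut.

(** * Fibers of a regular sequence of forms *)

Section GradedSequence.
Variables (K : fieldType) (N : nat) (h : ideal {mpoly K[N]}).
Local Notation S := {mpoly K[N]}.
Local Notation comp := (pihomog mdeg).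
Hypothesis h_comp : forall d x, h x -> h (comp d x).
Variables (n : nat) (s : 'I_n -> S) (w : 'I_n -> nat).
Hypothesis s_homog : forall i, s i \is (w i).-homog.
Hypothesis w_gt0 : forall i, (0 < w i)%N.
Hypothesis s_regular : forall k : 'I_n, forall x,
  cut_ideal h s k (x * s k) -> cut_ideal h s k x.

(** Together with [h] these elements cut out the fiber over [a]; as the degrees are positive, their
    top components are the forms [s i]. *)
Definition fiber (a : 'I_n -> K) (i : 'I_n) : S := s i - (a i)%:MP.

Lemma comp_mul_fiber a i e u : (msize u <= e.+1)%N ->
  comp (e + w i) (u * fiber a i) = comp e u * s i.
Proof.
move=> hu; rewrite /fiber mulrBr raddfB /= (comp_mul_homog _ _ (s_homog i)).
rewrite [X in _ - X]comp_small ?subr0 // mulrC mul_mpolyC.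
apply: leq_trans (msizeZ_le _ _) _; apply: leq_trans hu _.
by rewrite -addn1 leq_add2l.
Qed.

Lemma msize_mul_fiber a i u M : (msize u <= M - w i)%N -> (msize (u * fiber a i) <= M)%N.
Proof.
have [->|u0] := eqVneq u 0; first by rewrite mul0r msize0.
move=> hu; have u1 : (0 < msize u)%N by rewrite lt0n msize_poly_eq0.
have wM : (w i <= M)%N by rewrite leqNgt; apply/negP => Mw; move: hu u1; lia.
rewrite -[M](subnKC wM) mulrC; apply: msizeM_leq hu.
apply: leq_trans (msizeD_le _ _) _; rewrite geq_max; apply/andP; split.
  exact: msize_homog (s_homog i).
by rewrite msizeN msizeC; case: (a i != 0).
Qed.

(* A relation whose top components cancel is lowered in degree: regularity writes the top
   component of the last coefficient in terms of the previous forms. *)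
Lemma fiber_strict a k M y : (k <= n)%N -> (msize y <= M)%N ->
  cut_ideal h (fiber a) k y ->
  exists u : 'I_n -> S, h (y - \sum_(i < n | (i < k)%N) u i * fiber a i) /\
    forall i, (msize (u i) <= M - w i)%N.
Proof.
elim: k M y => [|k IHk] M y kn yM [u hu].
  exists (fun=> 0); split; last by move=> i; rewrite msize0.
  by move: hu; rewrite !big_pred0.
pose j := Ordinal kn.
have splitj (v : 'I_n -> S) : \sum_(i < n | (i < k.+1)%N) v i * fiber a i =
    v j * fiber a j + \sum_(i < n | (i < k)%N) v i * fiber a i.
  rewrite (bigD1 j) /=; last by rewrite ltnS leqnn.
  congr (_ + _); apply: eq_bigl => i; rewrite ltnS ltn_neqAle andbC.
  by rewrite -val_eqE.
have {u hu} [v hv] : exists v, cut_ideal h (fiber a) k (y - v * fiber a j).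
  exists (u j), u; move: hu; rewrite splitj opprD addrA //.
(* Descent on the size of [v], the coefficient of the last generator. *)
have [T] := ubnP (msize v); elim: T v hv => // T IHT v hv vT.
have [vs|vb] := leqP (msize v) (M - w j).
  have [|u' [hu' u'M]] := IHk M _ (ltnW kn) _ hv.
    apply: leq_trans (msizeD_le _ _) _; rewrite geq_max yM msizeN.
    exact: msize_mul_fiber.
  exists (fun i => if i == j then v else u' i); split; last first.
    by move=> i; case: eqP => [->|_].
  rewrite splitj eqxx opprD addrA.
  rewrite (eq_bigr (fun i => u' i * fiber a i)) // => i ik.
  by rewrite ifN //; apply/eqP => e; rewrite e /= ltnn in ik.
have v0 : (0 < msize v)%N by apply: leq_ltn_trans vb.
pose e := (msize v).-1; have ve : (msize v <= e.+1)%N by rewrite prednK.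
have Me : (M <= e + w j)%N by rewrite /e; move: vb v0 (w_gt0 j); lia.
have [|u' [hu' u'M]] := IHk (e + w j).+1 _ (ltnW kn) _ hv.
  apply: leq_trans (msizeD_le _ _) _; rewrite geq_max msizeN; apply/andP; split.
    exact: leq_trans yM (leqW Me).
  by apply: msize_mul_fiber; rewrite subSn ?leq_addl // addnK.
(* In degree [e + w j] the element [y] has no component, so the top part of [v] times [s j] is a
   combination of the earlier forms modulo [h]. *)
have : cut_ideal h s k (comp e v * s j).
  exists (fun i => - (if (w i <= e + w j)%N then comp (e + w j - w i) (u' i) else 0)).
  have := h_comp (e + w j) hu'; rewrite !pihomogB comp_sum.
  rewrite (comp_small (leq_trans yM Me)). rewrite sub0r comp_mul_fiber // => /idealN.
  rewrite opprB opprK addrC; congr (h _); congr (_ + _); rewrite -sumrN.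
  apply: eq_bigr => i ik; rewrite mulNr opprK; have := u'M i; case: (leqP (w i) (e + w j)) => wi ui.
    rewrite -{1}[(e + w j)%N](subnK wi); apply/esym; rewrite comp_mul_fiber //.
    by rewrite -subSn.
  by rewrite (_ : u' i = 0) ?mul0r ?raddf0 //; apply/eqP; rewrite -msize_poly_eq0; move: ui wi; lia.
move=> /(@s_regular j _)[u1 hu1].
pose z i := if (w i <= e)%N then comp (e - w i) (u1 i) else 0.
have {}hu1 : h (comp e v - \sum_(i < n | (i < k)%N) z i * s i).
  have := h_comp e hu1; rewrite pihomogB (pihomog_dE (pihomogP mdeg e v)) comp_sum; congr (h (_ - _)).
  by apply: eq_bigr => i _; rewrite (comp_mul_homog_sub _ _ (s_homog i)).
(* Regularity writes the top part of [v] through the earlier [s i]. Replacing each of them by the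
   scalar [a i] lowers the degree and changes [v] only by earlier fiber elements modulo [h]. *)
apply: (IHT (v - comp e v + \sum_(i < n | (i < k)%N) z i * (a i)%:MP)); last first.
  have : (msize (v - comp e v + \sum_(i < n | (i < k)%N) z i * (a i)%:MP) <= e)%N.
    apply: leq_trans (msizeD_le _ _) _; rewrite geq_max msize_sub_comp //=.
    apply: leq_trans (msize_sum _ _ _) _; apply/bigmax_leqP => i _.
    rewrite mulrC mul_mpolyC; apply: leq_trans (msizeZ_le _ _) _; rewrite /z.
    case: (leqP (w i) e) => [we|_]; last by rewrite msize0.
    by apply: leq_trans (msize_comp _ _) _; move: (w_gt0 i) we; lia.
  by move=> hle; apply: leq_ltn_trans hle _; rewrite /e; move: v0 vT; lia.
set q := \sum_(i < n | _) z i * _; set t := \sum_(i < n | _) z i * s i in hu1.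
have et : t - q = \sum_(i < n | (i < k)%N) z i * fiber a i.
  by rewrite -sumrB; apply: eq_bigr => i _; rewrite /fiber mulrBr.
have -> : y - (v - comp e v + q) * fiber a j = y - v * fiber a j
   + (fiber a j * (comp e v - t) + fiber a j * (t - q)) by ring.
apply: ideal_add => //; apply: ideal_add; apply: ideal_mul; first exact: cut_sub.
by rewrite et; apply: cut_sum.
Qed.

(** With the coefficients bounded by [fiber_strict], the components of degree M of a relation form a
    relation among the [s i]. *)
Lemma fiber_top a M y : (msize y <= M.+1)%N -> cut_ideal h (fiber a) n y ->
  cut_ideal h s n (comp M y).
Proof.
move=> yM /(fiber_strict (leqnn n) yM)[u [hu uM]].
exists (fun i => if (w i <= M)%N then comp (M - w i) (u i) else 0).
have := h_comp M hu; rewrite pihomogB comp_sum; congr (h (_ - _)).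
apply: eq_bigr => i _; have := uM i; case: (leqP (w i) M) => wi ui.
  by rewrite -{1}[M](subnK wi) comp_mul_fiber // -subSn.
by rewrite (_ : u i = 0) ?mul0r ?raddf0 //; apply/eqP; rewrite -msize_poly_eq0; move: ui wi; lia.
Qed.

Hypothesis special_prime : forall x y,
  cut_ideal h s n (x * y) -> cut_ideal h s n x \/ cut_ideal h s n y.
Hypothesis special_proper : ~ cut_ideal h s n 1.

Lemma fiber_proper a : ~ cut_ideal h (fiber a) n 1.
Proof.
have s1 : (msize (1 : S) <= 1)%N by rewrite msize1.
move=> /(fiber_top s1); rewrite pihomog_dE //; exact: dhomog1.
Qed.

(** If x squared lies in the fiber ideal, the square of its top component lies in the prime special
    ideal, hence so does the top component. Substituting [a i] for [s i] in it gives an element of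
    lower degree in the same class. *)
Lemma fiber_radical a x m : cut_ideal h (fiber a) n (x ^+ m.+1) -> cut_ideal h (fiber a) n x.
Proof.
apply: ideal_radical_of_square => {m}{}x.
have [D] := ubnP (msize x); elim: D x => // D IHD x xD hx.
case e : (msize x) => [|d].
  by move/eqP: e; rewrite msize_poly_eq0 => /eqP ->; apply: ideal_zero.
have xd : (msize x <= d.+1)%N by rewrite e.
have xx : (msize (x * x) <= (d + d).+1)%N by rewrite -addnS; apply: msizeM_leq.
have [u hu] : cut_ideal h s n (comp d x).
  have := fiber_top xx hx; rewrite (comp_topM xd xd); by case/special_prime.
pose v i := if (w i <= d)%N then comp (d - w i) (u i) else 0.
have hv : h (comp d x - \sum_(i < n | (i < n)%N) v i * s i).
  have := h_comp d hu; rewrite pihomogB (pihomog_dE (pihomogP mdeg d x)) comp_sum.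
  congr (h (_ - _)); apply: eq_bigr => i _; exact: comp_mul_homog_sub (s_homog i).
pose q := \sum_(i < n | (i < n)%N) v i * (a i)%:MP.
have et : \sum_(i < n | (i < n)%N) v i * s i - q = \sum_(i < n | (i < n)%N) v i * fiber a i.
  by rewrite -sumrB; apply: eq_bigr => i _; rewrite /fiber mulrBr.
have hd : cut_ideal h (fiber a) n (x - (x - comp d x + q)).
  have -> : x - (x - comp d x + q) = (comp d x - \sum_(i < n | (i < n)%N) v i * s i)
     + (\sum_(i < n | (i < n)%N) v i * s i - q) by ring.
  by apply: ideal_add; [exact: cut_sub | rewrite et; apply: cut_sum].
have : cut_ideal h (fiber a) n (x - comp d x + q).
  apply: IHD; last first.
    by have := ideal_exp_congr 2 hd; rewrite !expr2 => /ideal_congr; apply.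
  have : (msize (x - comp d x + q) <= d)%N.
    apply: leq_trans (msizeD_le _ _) _; rewrite geq_max msize_sub_comp //=.
    apply: leq_trans (msize_sum _ _ _) _; apply/bigmax_leqP => i _.
    rewrite mulrC mul_mpolyC; apply: leq_trans (msizeZ_le _ _) _; rewrite /v.
    case: (leqP (w i) d) => [we|_]; last by rewrite msize0.
    by apply: leq_trans (msize_comp _ _) _; move: (w_gt0 i) we; lia.
  by move=> hle; apply: leq_ltn_trans hle _; move: xD; rewrite e.
by move=> hy; rewrite -[x](subrK (x - comp d x + q)); apply: ideal_add.
Qed.

Definition eval_seq : {mpoly K[n]} -> S := mmap (@mpolyC N K) s.
HB.instance Definition _ := GRing.RMorphism.copy eval_seq (mmap (@mpolyC N K) s).

Lemma eval_seqC x : eval_seq x%:MP = x%:MP.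
Proof. exact: mmapC. Qed.

Lemma eval_seqX i : eval_seq 'X_i = s i.
Proof. by rewrite /eval_seq mmapX mmap1U. Qed.

Lemma eval_seq_fiber a q : cut_ideal h (fiber a) n (eval_seq q - (q.@[a])%:MP).
Proof.
have -> : eval_seq q - (q.@[a])%:MP = \sum_(m <- msupp q)
    (q@_m)%:MP * (mmap1 s m - (\prod_(i < n) a i ^+ m i)%:MP).
  rewrite /eval_seq /mmap mevalE (raddf_sum (@mpolyC N K)) -sumrB.
  by apply: eq_bigr => m _; rewrite mulrBr -mpolyCM.
apply: (ideal_sum (I := cut_ideal h (fiber a) n)) => m _; apply: ideal_mul.
rewrite /mmap1 rmorph_prod; apply: (ideal_prod_congr (I := cut_ideal h (fiber a) n)) => i.
rewrite rmorphXn; apply: (ideal_exp_congr (I := cut_ideal h (fiber a) n)); exact: (cut_gen h (fiber a) (ltn_ord i)).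
Qed.

(** At a zero [a] of [b] the image of [b] vanishes in the fiber, so an inverse would put 1 in the
    fiber ideal. *)
Lemma eval_seq_unit b u : h (eval_seq b * u - 1) -> forall a, b.@[a] != 0.
Proof.
move=> hu a; apply/eqP => ba; apply: (fiber_proper (a := a)).
apply: ideal_congr (cut_sub _ _ hu) _.
by apply: idealMr; have := eval_seq_fiber a b; rewrite ba mpolyC0 subr0.
Qed.

Section Basis.
Variable D : nat.
Local Notation mon := 'X_{1..N < D}.

(** Linear independence over [K] in the special fiber. Bounding the degree of the monomials by [D]
    leaves finitely many, so a maximal independent set exists. *)
Definition independent (B : {set mon}) := forall k : mon -> K,
  cut_ideal h s n (\sum_(m in B) k m *: 'X_[m]) -> forall m, m \in B -> k m = 0.

Lemma max_independent : exists B : {set mon}, independent B /\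
  forall m : mon, exists k : mon -> K, cut_ideal h s n ('X_[m] - \sum_(b in B) k b *: 'X_[b]).
Proof.
have i0 : `[< independent finset.set0 >] by apply/asboolP => k _ m; rewrite finset.in_set0.
have [B /maxsetP[/asboolP iB maxB] _] := maxset_exists (P := fun B => `[< independent B >]) i0.
exists B; split=> // m.
have [mB|mB] := boolP (m \in B).
  exists (fun b => if b == m then 1 else 0).
  have -> : \sum_(b in B) (if b == m then 1 else 0) *: 'X_[b] = 'X_[m] :> S.
    rewrite (bigD1 m) //= eqxx scale1r big1 ?addr0 //.
    by move=> b /andP[_ /negbTE ->]; rewrite scale0r.
  by rewrite subrr; apply: ideal_zero.
have : ~ independent (m |: B).
  move=> ind; move: mB; rewrite -(maxB (m |: B)) ?finset.setU11 ?finset.subsetUr //; exact/asboolP.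
move=> /existsNP[k /not_implyP[hk /existsNP[m' /not_implyP[m'B km']]]].
have {}hk : cut_ideal h s n (k m *: 'X_[m] + \sum_(b in B) k b *: 'X_[b]).
  by move: hk; rewrite big_setU1.
have km : k m != 0.
  apply/eqP => km; move: hk; rewrite km scale0r add0r => /iB kB.
  by move: m'B; rewrite finset.in_setU1 => /orP[/eqP e|/kB //]; rewrite e in km'.
exists (fun b => - (k m)^-1 * k b).
have := ideal_mul (k m)^-1%:MP hk; rewrite mulrDr !mul_mpolyC scalerA mulVf // scale1r.
congr (cut_ideal _ _ _ (_ + _)); rewrite scaler_sumr -sumrN; apply: eq_bigr => b _.
by rewrite scalerA mulNr scaleNr opprK.
Qed.

(** The part of highest degree of a nontrivial relation in a fiber would be a nontrivial relation in
    the special fiber. *)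
Lemma independent_fiber B a (k : mon -> K) : independent B ->
  cut_ideal h (fiber a) n (\sum_(m in B) k m *: 'X_[m]) -> forall m, m \in B -> k m = 0.
Proof.
move=> iB hk m mB; apply: contrapT => /eqP km.
have mP : (m \in B) && (k m != 0) by rewrite mB.
case: (@arg_maxnP _ m (fun b : mon => (b \in B) && (k b != 0)) (fun b : mon => mdeg b) mP) => b /andP[bB kb] maxb.
have sz : (msize (\sum_(m in B) k m *: 'X_[m]) <= (mdeg b).+1)%N.
  apply: leq_trans (msize_sum _ _ _) _; apply/bigmax_leqP => c cB.
  have [->|kc] := eqVneq (k c) 0; first by rewrite scale0r msize0.
  by apply: leq_trans (msizeZ_le _ _) _; rewrite msizeX ltnS; apply: maxb; rewrite cB.
have := fiber_top sz hk; rewrite comp_sum.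
rewrite (eq_bigr (fun c : mon => (if mdeg c == mdeg b then k c else 0) *: 'X_[c])); last first.
  move=> c _; rewrite linearZ /= pihomogX.
  by case: ifP; rewrite ?scaler0 ?scale0r.
by move=> /iB/(_ b bB)/eqP; rewrite eqxx (negbTE kb).
Qed.

(** Graded Nakayama: a top component lies in the span of B up to multiples of the [s i], whose
    coefficients have smaller degree because the [w i] are positive. *)
Lemma basis_span (B : {set mon}) : (forall m : mon, exists k : mon -> K,
    cut_ideal h s n ('X_[m] - \sum_(b in B) k b *: 'X_[b])) ->
  forall x, (msize x <= D)%N -> exists W : mon -> {mpoly K[n]},
    h (x - \sum_(b in B) eval_seq (W b) * 'X_[b]).
Proof.
move=> spB x.
have spanx M y : (msize y <= M)%N -> (M <= D)%N -> exists k : mon -> K,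
    cut_ideal h s n (y - \sum_(b in B) k b *: 'X_[b]).
  move=> yM MD; have [k hk] := choice spB.
  exists (fun b => \sum_(m : mon) y@_m * k m b).
  rewrite {1}[y](mpolywE (k := D)) ?(leq_trans yM) //.
  have -> : \sum_(b in B) (\sum_(m : mon) y@_m * k m b) *: 'X_[b] =
      \sum_(m : mon) y@_m *: \sum_(b in B) k m b *: 'X_[b] :> S.
    rewrite (eq_bigr (fun b : mon => \sum_(m : mon) (y@_m * k m b) *: 'X_[b])).
      rewrite exchange_big; apply: eq_bigr => m _ /=; rewrite scaler_sumr.
      by apply: eq_bigr => b _; rewrite scalerA.
    by move=> b _; rewrite scaler_suml.
  rewrite -sumrB; apply: (ideal_sum (I := cut_ideal h s n)) => m _; rewrite -scalerBr -mul_mpolyC.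
  exact: ideal_mul.
suff main M : (M <= D)%N -> forall y, (msize y <= M)%N -> exists W : mon -> {mpoly K[n]},
    h (y - \sum_(b in B) eval_seq (W b) * 'X_[b]) by exact: main.
elim: M => [|M IHM] MD y yM.
  exists (fun=> 0); rewrite (eq_bigr (fun=> 0)) => [|b _]; last by rewrite rmorph0 mul0r.
  move: yM; rewrite leqn0 msize_poly_eq0 => /eqP ->.
  by rewrite big1 // subr0; apply: ideal_zero.
have [k hk] := spanx _ _ (msize_comp M y) MD.
have [u hu] := hk.
have hu' := h_comp M hu; rewrite pihomogB in hu'.
rewrite pihomogB (pihomog_dE (pihomogP mdeg M y)) !comp_sum in hu'.
pose v i := if (w i <= M)%N then comp (M - w i) (u i) else 0.
have vM i : (msize (v i) <= M)%N.
  rewrite /v; case: (leqP (w i) M) => [wi|_]; last by rewrite msize0.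
  by apply: leq_trans (msize_comp _ _) _; move: (w_gt0 i) wi; lia.
have [W hW] := choice (fun i => IHM (ltnW MD) (v i) (vM i)).
have [W' hW'] := IHM (ltnW MD) _ (msize_sub_comp yM).
(* The three terms come from the scalars of the top component, from the multiples of [s i], and from
   the lower components of [y]. *)
exists (fun b : mon => (if mdeg b == M then k b else 0)%:MP + \sum_(i < n) 'X_i * W i b + W' b).
have e1 : \sum_(b in B) comp M (k b *: 'X_[b]) =
    \sum_(b in B) eval_seq (if mdeg b == M then k b else 0)%:MP * 'X_[b].
  apply: eq_bigr => b _; rewrite linearZ /= pihomogX eval_seqC mul_mpolyC.
  by case: ifP => _; rewrite ?scaler0 ?scale0r.
have e2 : \sum_(i < n | (i < n)%N) comp M (u i * s i) = \sum_(i < n) v i * s i.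
  apply: eq_big => [i|i _]; first by rewrite ltn_ord.
  exact: comp_mul_homog_sub (s_homog i).
have e3 : \sum_(b in B) eval_seq (\sum_(i < n) 'X_i * W i b) * 'X_[b] =
    \sum_(i < n) s i * \sum_(b in B) eval_seq (W i b) * 'X_[b].
  rewrite (eq_bigr (fun b : mon => \sum_(i < n) s i * (eval_seq (W i b) * 'X_[b]))).
    by rewrite exchange_big; apply: eq_bigr => i _; rewrite mulr_sumr.
  move=> b _; rewrite rmorph_sum mulr_suml; apply: eq_bigr => i _.
  by rewrite rmorphM /= eval_seqX mulrA.
rewrite e1 e2 in hu'.
rewrite (eq_bigr (fun b : mon => eval_seq (if mdeg b == M then k b else 0)%:MP * 'X_[b]
   + eval_seq (\sum_(i < n) 'X_i * W i b) * 'X_[b] + eval_seq (W' b) * 'X_[b])); last first.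
  by move=> b _; rewrite !rmorphD !mulrDl.
rewrite !big_split /= e3.
set s1 := \sum_(b in B) _ in hu' *; set s2 := \sum_(i < n) s i * _.
set s3 := \sum_(b in B) _ in hW' *; set s4 := \sum_(i < n) v i * _ in hu'.
have -> : y - (s1 + s2 + s3) = (y - comp M y - s3) + (comp M y - s1 - s4) + (s4 - s2) by ring.
apply: ideal_add; first exact: ideal_add.
rewrite -sumrB; apply: ideal_sum => i _; rewrite mulrC -mulrBr; exact: ideal_mul.
Qed.
End Basis.

(** Expand x in the independent monomials with coefficients from [{mpoly K[n]}]. Over a common zero
    of p and q the fiber is reduced, so x vanishes in it and so do all coefficients; [nss] then puts
    them in (p, q). *)
Lemma radical_membership (p q : {mpoly K[n]}) x m :
  (forall W, (forall a, p.@[a] = 0 -> q.@[a] = 0 -> W.@[a] = 0) ->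
     exists u v, W = u * p + v * q) ->
  (exists u v, h (x ^+ m.+1 - (u * eval_seq p + v * eval_seq q))) ->
  exists u v, h (x - (u * eval_seq p + v * eval_seq q)).
Proof.
move=> nss [u0 [v0 hx]].
have [D xD] : exists D, (msize x <= D)%N by exists (msize x).
have [B [iB spB]] := max_independent D.
have [W hW] := basis_span spB xD.
have W0 b : b \in B -> exists u v, W b = u * p + v * q.
  move=> bB; apply: nss => a pa qa.
  have hxa : cut_ideal h (fiber a) n x.
    apply: (@fiber_radical a x m); rewrite -[_ ^+ _](subrK (u0 * eval_seq p + v0 * eval_seq q)).
    apply: ideal_add; first exact: cut_sub.
    have := eval_seq_fiber a p; have := eval_seq_fiber a q.
    by rewrite pa qa mpolyC0 !subr0 => hq hp; apply: ideal_add; apply: ideal_mul.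
  apply: (independent_fiber iB (a := a) (k := fun b => (W b).@[a])) bB.
  apply: ideal_congr hxa; rewrite -[x](subrK (\sum_(b in B) eval_seq (W b) * 'X_[b])) -addrA.
  apply: ideal_add; first exact: cut_sub.
  rewrite -sumrB; apply: (ideal_sum (I := cut_ideal h (fiber a) n)) => c _; rewrite -mul_mpolyC -mulrBl.
  exact/idealMr/eval_seq_fiber.
have {}W0 b : exists u v, b \in B -> W b = u * p + v * q.
  have [bB|nB] := boolP (b \in B); first by have [u [v e]] := W0 b bB; exists u, v.
  by exists 0, 0.
have [U hU] := choice W0; have [V hV] := choice hU.
exists (\sum_(b in B) eval_seq (U b) * 'X_[b]), (\sum_(b in B) eval_seq (V b) * 'X_[b]).
move: hW; congr (h (_ - _)); rewrite !mulr_suml -big_split; apply: eq_bigr => b bB.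
by rewrite hV // rmorphD !rmorphM /=; ring.
Qed.
End GradedSequence.

(** * Cardinals from bounds on injective families *)

Lemma injective_card_le (T : Type) (A : set T) B :
  (forall m (Q : 'I_m -> T), (forall i, A (Q i)) -> injective Q -> (m <= B)%N) ->
  (A #<= `I_B)%card.
Proof.
move=> hA; have key m : (`I_m #<= A)%card -> (m <= B)%N.
  move=> /pcard_surjP[f fs].
  have /choice[Q hQ] (i : 'I_m) : exists x, A x /\ f x = i.
    by have [x Ax <-] := fs _ (ltn_ord i); exists x.
  apply: (hA m Q) => [i|i j eij]; first by have [] := hQ i.
  by apply: val_inj; have [_ /= fi] := hQ i; have [_ /= fj] := hQ j; rewrite /= -fi -fj eij.
have [/finite_setP[m mA]|/infiniteP iA] := pselect (finite_set A).
  by rewrite (card_le_eql mA) card_le_II key // (card_le_eqr mA).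
(* An infinite set would contain [B.+1] distinct elements. *)
have : (`I_B.+1 #<= A)%card by apply: card_le_trans iA; apply: card_leT.
by move/key; rewrite ltnn.
Qed.

Lemma injective_card_range (T : Type) l (Q : 'I_l -> T) : injective Q -> (range Q #= `I_l)%card.
Proof.
move=> iQ; have h1 : (range Q #= [set: 'I_l])%card by apply: inj_card_eq => i j _ _; apply: iQ.
apply: card_eq_trans h1 _; rewrite card_eq_sym.
have -> : `I_l = range (@nat_of_ord l).
  apply/seteqP; split=> [i /= il|_ [i _ <-]] /=; last exact: ltn_ord.
  by exists (Ordinal il).
by apply: inj_card_eq => i j _ _; apply: val_inj.
Qed.

(** * Passage between a quotient of the polynomial ring and its ideals *)

Lemma span_natP (A : comPzRingType) (s : seq A) x :
  ideal_span s x <-> exists c : nat -> A, x = \sum_(i < size s) c i * s`_i.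
Proof.
split=> [[c ->]|[c ->]]; last by exists (fun i => c i).
exists (fun i => if insub i is Some j then c j else 0).
by apply: eq_bigr => i _; rewrite valK.
Qed.

Lemma span_mem (A : comPzRingType) (s : seq A) i : (i < size s)%N -> ideal_span s s`_i.
Proof.
move=> lti; exists (fun j => if j == Ordinal lti then 1 else 0).
rewrite (bigD1 (Ordinal lti)) //= eqxx mul1r big1 ?addr0 // => j /negbTE ->.
by rewrite mul0r.
Qed.

Section QuotientProjection.
Variables (A : comPzRingType) (I : ideal A).

Lemma quot_proj_is_zmod_morphism : zmod_morphism (quot_proj I).
Proof.
move=> x y; apply: (addIr (quot_proj I y)); rewrite subrK.
by rewrite /quot_proj quot_addE subrK.
Qed.

Lemma quot_proj_is_monoid_morphism : monoid_morphism (quot_proj I).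
Proof. by split=> // x y; rewrite /quot_proj -quot_mulE. Qed.

HB.instance Definition _ :=
  GRing.isZmodMorphism.Build A (ideal_quotient I) (quot_proj I) quot_proj_is_zmod_morphism.
HB.instance Definition _ :=
  GRing.isMonoidMorphism.Build A (ideal_quotient I) (quot_proj I) quot_proj_is_monoid_morphism.

Lemma quot_projP x y : quot_proj I x = quot_proj I y <-> I (x - y).
Proof. by split=> [/eqP/quot_piP|/quot_piP/eqP]. Qed.

Lemma quot_proj0P x : quot_proj I x = 0 <-> I x.
Proof. by rewrite -[x in I x]subr0 -quot_projP rmorph0. Qed.

Lemma quot_proj_surj (a : ideal_quotient I) : exists x, a = quot_proj I x.
Proof. by exists (repr a); rewrite /quot_proj reprK. Qed.
End QuotientProjection.

Lemma ideal_span_homogeneous (K : fieldType) N (H : seq {mpoly K[N]}) :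
  (forall h, h \in H -> exists e, h \is e.-homog) ->
  forall d x, ideal_span H x -> ideal_span H (pihomog mdeg d x).
Proof.
move=> hH d x /span_natP[c ->]; rewrite comp_sum; apply: ideal_sum => i _.
have [e he] := hH _ (mem_nth 0 (ltn_ord i)).
by rewrite (comp_mul_homog_sub _ _ he); apply: ideal_mul; apply: span_mem.
Qed.

Section SequenceInQuotient.
Variables (K : closedFieldType) (N : nat) (I : ideal {mpoly K[N]}).
Local Notation S := {mpoly K[N]}.
Local Notation R := (ideal_quotient I).
Local Notation proj := (quot_proj I).

Lemma subalgebra_eval (t : seq R) (s : 'I_(size t) -> S) a :
  (forall i : 'I_(size t), t`_i = proj (s i)) -> subalgebra t a -> exists q, a = proj (eval_seq s q).
Proof.
move=> ts [q ->]; exists q; rewrite /eval_seq /mmap rmorph_sum.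
apply: eq_bigr => m _; rewrite rmorphM; congr (_ * _).
by rewrite /mmap1 rmorph_prod; apply: eq_bigr => i _; rewrite rmorphXn ts.
Qed.

Variables (L : seq R) (s : 'I_(size L) -> S).
Hypothesis Ls : forall i : 'I_(size L), L`_i = proj (s i).
Local Notation n := (size L).

(** Lifting coefficients to polynomials turns the hypotheses on [L] in the quotient into statements
    about [cut_ideal]. *)
Lemma cut_idealP k y : (k <= n)%N ->
  cut_ideal I s k y <-> ideal_span (take k L) (proj y).
Proof.
move=> kn; have sk : size (take k L) = k by rewrite size_takel.
split=> [[u /quot_projP ->]|].
  have -> : proj (\sum_(i < n | (i < k)%N) u i * s i) =
      \sum_(i < n | (i < k)%N) proj (u i) * L`_i.
    by rewrite rmorph_sum; apply: eq_bigr => i _; rewrite rmorphM Ls.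
  apply: (ideal_sum (I := ideal_span (take k L))) => i ik; apply: ideal_mul.
  by rewrite -(nth_take 0 ik); apply: span_mem; rewrite sk.
move=> /span_natP[c ec]; have [u hu] := choice (fun i => quot_proj_surj (c i)).
have lt (i : 'I_(size (take k L))) : (i < n)%N.
  by apply: leq_trans (ltn_ord i) _; rewrite sk.
have lk (i : 'I_(size (take k L))) : (i < k)%N by apply: leq_trans (ltn_ord i) _; rewrite sk.
pose z := \sum_(i < size (take k L)) u i * s (Ordinal (lt i)).
rewrite -[y](subrK z); apply: ideal_add.
  apply: cut_sub; apply/quot_projP; rewrite ec rmorph_sum.
  by apply: eq_bigr => i _; rewrite rmorphM hu nth_take //= (Ls (Ordinal (lt i))).
apply: (ideal_sum (I := cut_ideal I s k)) => i _; apply: ideal_mul.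
by apply: cut_gen; apply: lk.
Qed.

Lemma cut_ideal_full y : cut_ideal I s n y <-> ideal_span L (proj y).
Proof. by rewrite cut_idealP // take_size. Qed.

Lemma cut_ideal_regular : regular_sequence L -> forall (k : 'I_n) x,
  cut_ideal I s k (x * s k) -> cut_ideal I s k x.
Proof.
move=> [reg _] k x; rewrite !(cut_idealP _ (ltnW (ltn_ord k))) => hx.
apply/quot_proj0P; apply: (reg k (ltn_ord k)).
by rewrite -rmorphM; apply/quot_proj0P; rewrite mulrC Ls -rmorphM.
Qed.

Lemma cut_ideal_proper : regular_sequence L -> ~ cut_ideal I s n 1.
Proof.
move=> [_ L1] /cut_ideal_full; rewrite rmorph1 => /quot_proj0P; rewrite rmorph1.
exact: L1.
Qed.

Lemma cut_ideal_prime : (0 < n)%N -> prime_sequence L -> forall x y,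
  cut_ideal I s n (x * y) -> cut_ideal I s n x \/ cut_ideal I s n y.
Proof.
move=> n0 [_ /(_ n)]; rewrite n0 leqnn take_size => /(_ isT)[_ dom] x y.
rewrite !cut_ideal_full rmorphM => /quot_proj0P; rewrite rmorphM => /dom.
by rewrite !quot_proj0P.
Qed.

Lemma cut_ideal_le k x : (k <= n)%N -> cut_ideal I s k x -> cut_ideal I s n x.
Proof.
move=> kn [u hu]; exists (fun i : 'I_n => if (i < k)%N then u i else 0).
move: hu; congr (I (_ - _)); rewrite big_mkcond; apply: eq_big => [i|i _].
  by rewrite ltn_ord.
by case: ifP => //; rewrite mul0r.
Qed.

(** A constant [s i] is invertible or zero. In the first case 1 lies in the ideal at once, in the
    second by regularity applied to 1; properness excludes both. *)
Lemma regular_degree_gt0 (w : 'I_n -> nat) : regular_sequence L ->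
  (forall i, s i \is (w i).-homog) -> forall i, (0 < w i)%N.
Proof.
move=> reg hs i; rewrite lt0n; apply/negP => /eqP wi.
have := hs i; rewrite wi => /msize_homog/msize1_polyC si.
apply: (cut_ideal_proper reg).
have [c0|c0] := eqVneq (s i)@_0 0.
  apply: (cut_ideal_le (ltnW (ltn_ord i))); apply: (cut_ideal_regular reg).
  by rewrite si c0 mpolyC0 mulr0; apply: ideal_zero.
have -> : 1 = ((s i)@_0)^-1%:MP * s i by rewrite {2}si -mpolyCM mulVf.
by apply: ideal_mul; apply: cut_gen.
Qed.
End SequenceInQuotient.

(** * Subsets of the variables and weighted degrees *)

Section Renaming.
Variables (K : closedFieldType) (a n : nat) (e : 'I_a -> 'I_n).

Definition rename_vars : {mpoly K[a]} -> {mpoly K[n]} :=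
  mmap (@mpolyC n K) (fun i => 'X_(e i)).
HB.instance Definition _ :=
  GRing.RMorphism.copy rename_vars (mmap (@mpolyC n K) (fun i => 'X_(e i))).

Lemma rename_varsC x : rename_vars x%:MP = x%:MP.
Proof. exact: mmapC. Qed.

Lemma rename_varsX i : rename_vars 'X_i = 'X_(e i).
Proof. by rewrite /rename_vars mmapX mmap1U. Qed.

Lemma eval_seq_rename N (s : 'I_n -> {mpoly K[N]}) q :
  eval_seq s (rename_vars q) = eval_seq (s \o e) q.
Proof.
apply: (mpoly_rmorph_eq (f := eval_seq s \o rename_vars) (g := eval_seq (s \o e))) => [x|i] /=.
  by rewrite rename_varsC !eval_seqC.
by rewrite rename_varsX !eval_seqX.
Qed.

Lemma shift_rename w (c : 'I_n -> K) q : (forall i, c (e i) = 0) ->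
  shift w c (rename_vars q) = (rename_vars q)%:P.
Proof.
move=> ce; apply: (mpoly_rmorph_eq (f := shift w c \o rename_vars)
  (g := polyC \o rename_vars)) => [x|i] /=; first by rewrite rename_varsC shiftC.
by rewrite rename_varsX shiftX /shift_var ce mpolyC0 scale0r addr0.
Qed.
End Renaming.

Section Weights.
Variables (K : closedFieldType) (n : nat).

(** A monomial of weighted degree d is sent to a form of degree d, so a homogeneous element of the
    subalgebra has a weighted homogeneous representative. *)
Lemma comp_eval_seq N (s : 'I_n -> {mpoly K[N]}) w d q :
  (forall i, s i \is (w i).-homog) ->
  pihomog mdeg d (eval_seq s q) = eval_seq s (top_form w d q).
Proof.
move=> hs; rewrite {1}[q]mpolyE /top_form !rmorph_sum comp_sum [RHS]big_mkcond.
apply: eq_bigr => m _; rewrite -mul_mpolyC rmorphM /= eval_seqC mul_mpolyC linearZ /=.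
have hm : eval_seq s 'X_[m] \is (wdeg w m).-homog.
  rewrite /eval_seq mmapX /mmap1 /wdeg.
  elim: (index_enum _) => [|i r IHr]; first by rewrite !big_nil dhomog1.
  by rewrite !big_cons; apply: dhomogM => //; rewrite mulnC; apply: dhomogMn.
case: eqP => [<-|/eqP ne]; first by rewrite pihomog_dE // -mul_mpolyC.
by rewrite (pihomog_ne0 ne hm) scaler0.
Qed.

(** Setting the variables in [z] to zero keeps the monomial [m], so what remains is nonzero and has
    a nonroot. *)
Lemma nonroot_on_face (p : {mpoly K[n]}) (z : pred 'I_n) m :
  m \in msupp p -> (forall i, z i -> m i = 0%N) ->
  exists c, (forall i, z i -> c i = 0) /\ p.@[c] != 0.
Proof.
move=> mp mz; pose on_face (m : 'X_{1..n}) := [forall i, z i ==> (m i == 0%N)].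
have faceP (m' : 'X_{1..n}) : reflect (forall i, z i -> m' i = 0%N) (on_face m').
  apply: (iffP forallP) => [hm i zi|hm i]; first by have := hm i; rewrite zi => /eqP.
  by apply/implyP => /hm ->.
pose p1 := \sum_(m <- msupp p | on_face m) p@_m *: 'X_[m].
have p10 : p1 != 0.
  apply/eqP => /mpolyP/(_ m); rewrite /p1 raddf_sum big_mkcond /= (bigD1_seq m) //=.
  have -> : on_face m by apply/faceP.
  rewrite mcoeffZ mcoeffX eqxx mulr1 big1 ?addr0 ?mcoeff0.
    by move/eqP; rewrite mcoeff_eq0 mp.
  by move=> m' ne; case: ifP => // _; rewrite mcoeffZ mcoeffX (negbTE ne) mulr0.
have [v v0] := mpoly_nonroot p10.
pose c i := if z i then 0 else v i; exists c; split=> [i zi|]; first by rewrite /c zi.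
suff -> : p.@[c] = p1.@[v] by [].
rewrite [LHS]mevalE /p1 raddf_sum [RHS]big_mkcond /=.
apply: eq_bigr => m' _; case: faceP => [hm|/existsNP[i /not_implyP[zi mi]]].
  rewrite /= mevalZ mevalX; congr (_ * _); apply: eq_bigr => i _.
  by rewrite /c; case: ifP => // /hm ->; rewrite !expr0.
rewrite (bigD1 i) //= /c zi expr0n; case: eqP => // _; by rewrite mul0r mulr0.
Qed.
End Weights.

(** * Transfer to the quotient ring and the count of prime factors *)

Theorem corollary4p31 (K : closedFieldType) (charK : [pchar K] =i pred0)
    (N eta : nat) (eta_ge3 : (3 <= eta)%N)
    (H : seq {mpoly K[N]})
    (H_forms : forall h, h \in H -> exists e, h \is e.-homog)
    (H_seq : R_sequence eta H)
    (g f : seq (ideal_quotient (ideal_span H)))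
    (gf_homog : forall a, a \in g ++ f -> homogeneous a)
    (gf_prime : prime_sequence (g ++ f))
    (d : nat) (d_ge1 : (1 <= d)%N)
    (P : ideal_quotient (ideal_span H))
    (P_sqfree : square_free P)
    (P_homog : homog_of_degree d P)
    (P_alg : subalgebra (g ++ f) P)
    (P_notin : ~ ideal_span f P) :
  let admissible (Q : ideal_quotient (ideal_span H)) :=
    [/\ subalgebra f Q,
        square_free Q /\ (exists2 e, (0 < e)%N & homog_of_degree e Q)
      & ~ radical_ideal (ideal_span [:: P; Q])] in
  (forall (l : nat) (Q : 'I_l -> ideal_quotient (ideal_span H)),
     (forall i, admissible (Q i)) ->
     (forall i j, i <> j -> no_common_factor (Q i) (Q j)) ->
     (range Q #= `I_l)%card /\ (l <= d ^ 2 * (2 * d - 1))%N) /\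
  (forall calH : set (ideal_quotient (ideal_span H)),
     (forall Q, calH Q -> admissible Q) ->
     (forall Q Q', calH Q -> calH Q' -> Q <> Q' -> no_common_factor Q Q') ->
     (calH #<= `I_(d ^ 2 * (2 * d - 1))%N)%card).
Proof.
move=> admissible; set I := ideal_span H in g f gf_homog gf_prime P P_sqfree P_homog P_alg P_notin admissible *.
set L := g ++ f; pose n := size L.
have [gf_reg _] := gf_prime.
have /choice[sw hsw] (i : 'I_n) : exists sw : {mpoly K[N]} * nat,
    sw.1 \is sw.2.-homog /\ L`_i = quot_proj I sw.1.
  by have [e [x xe ->]] := gf_homog _ (mem_nth 0 (ltn_ord i)); exists (x, e).
pose s i := (sw i).1; pose w i := (sw i).2.
have s_homog i : s i \is (w i).-homog by have [] := hsw i.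
have Ls (i : 'I_n) : L`_i = quot_proj I (s i) by have [] := hsw i.
have Icomp := ideal_span_homogeneous H_forms.
have w0 := regular_degree_gt0 Ls gf_reg s_homog.
have [q0 eP0] := subalgebra_eval Ls P_alg.
have [p0 p0_homog eP1] := P_homog.
pose p := top_form w d q0.
have eP : P = quot_proj I (eval_seq s p).
  rewrite /p -comp_eval_seq // eP1; apply/quot_projP.
  rewrite -(pihomog_dE p0_homog) -raddfB; apply: Icomp; apply/quot_projP.
  by rewrite -eP1.
have pd m : m \in msupp p -> wdeg w m = d.
  rewrite mcoeff_msupp mcoeff_top_form; case: (wdeg w m =P d) => // _.
  by rewrite eqxx.
(* Without generators every monomial has weight 0, below d, which forces P = 0. *)
have n0 : (0 < n)%N.
  rewrite lt0n; apply/negP => /eqP n0; apply: P_notin; rewrite eP.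
  suff -> : p = 0 by rewrite !rmorph0; apply: ideal_zero.
  apply/mpolyP => m; rewrite mcoeff0; apply/eqP; rewrite mcoeff_eq0; apply/negP => /pd.
  rewrite /wdeg big1 => [d0|i _]; first by rewrite -d0 in d_ge1.
  by have := ltn_ord i; rewrite [X in (_ < X)%N]n0.
have prm := cut_ideal_prime Ls n0 gf_prime.
have prop := cut_ideal_proper Ls gf_reg.
have reg := cut_ideal_regular Ls gf_reg.
(* An inverse in the quotient makes [b] nonzero at every point, hence a unit. *)
have unit_lift b : is_unit (quot_proj I (eval_seq s b)) -> is_unit b.
  move=> [x ex]; have [y ey] := quot_proj_surj x.
  apply: nowhere_zero_unit; apply: (eval_seq_unit Icomp s_homog w0 reg prop (u := y)).
  apply/quot_projP; transitivity (quot_proj I (eval_seq s b) * quot_proj I y).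
    exact: rmorphM.
  by rewrite -ey ex; apply/esym/rmorph1.
have div_proj a b : divides a b ->
    divides (quot_proj I (eval_seq s a)) (quot_proj I (eval_seq s b)).
  by move=> [x ->]; exists (quot_proj I (eval_seq s x)); rewrite !rmorphM.
have sqf_lift b : square_free (quot_proj I (eval_seq s b)) -> square_free b.
  move=> hb x /div_proj; rewrite !rmorphM => /hb; exact: unit_lift.
have p_sqf : square_free p by apply: sqf_lift; rewrite -eP.
(* Otherwise every monomial of [p] would involve a variable mapped into [f], and P would lie in
   (f). *)
have [c [cz pc]] : exists c, (forall i : 'I_n, (size g <= i)%N -> c i = 0) /\ p.@[c] != 0.
  apply: contrapT => hc; apply: P_notin; rewrite eP.
  have -> : eval_seq s p = \sum_(m <- msupp p) eval_seq s (p@_m *: 'X_[m]).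
    by rewrite {1}[p]mpolyE rmorph_sum.
  rewrite rmorph_sum big_seq.
  apply: (ideal_sum (I := ideal_span f)) => m mp.
  change (ideal_span f (quot_proj I (eval_seq s (p@_m *: 'X_[m])))).
  have [i gi mi] : exists2 i : 'I_n, (size g <= i)%N & m i != 0%N.
    apply: contrapT => hi; apply: hc.
    apply: (nonroot_on_face (z := fun i : 'I_n => (size g <= i)%N) mp) => i gi.
    by apply/eqP; apply: contrapT => /negP mi; apply: hi; exists i.
  have fi : ideal_span f (quot_proj I (s i)).
    rewrite -Ls nth_cat ltnNge gi /=; apply: span_mem.
    by rewrite ltn_subLR // -size_cat.
  have [m' ->] : exists m', m = (U_(i) + m')%MM.
    by exists (m - U_(i))%MM; rewrite addmC submK // lep1mP.
  have -> : quot_proj I (eval_seq s (p@_(U_(i) + m') *: 'X_[U_(i) + m'])) =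
      quot_proj I (eval_seq s ((p@_(U_(i) + m'))%:MP * 'X_[m'])) * quot_proj I (s i).
    by rewrite -mul_mpolyC mpolyXD mulrCA mulrC 2!rmorphM /= eval_seqX.
  exact: ideal_mul.
have top_p : top_form w d p = p.
  by apply/mpolyP => m; rewrite mcoeff_top_form /p mcoeff_top_form; case: (wdeg w m == d).
have pd_le m : m \in msupp p -> (wdeg w m <= d)%N by move/pd ->.
have bnd := shift_bound_mpoly c w0 pd_le; rewrite top_p in bnd.
have dS : d = d.-1.+1 by rewrite prednK.
rewrite dS in bnd.
have sF := shift_bound_size bnd pc.
pose D := disc (shift w c p).
have D0 : D != 0 by apply: disc_shift_neq0; rewrite ?sF.
(* All weights are at least 1, so the ordinary degree is at most the weighted degree d. *)
have p_size : ((msize p).-1 <= d)%N.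
  have p0' := square_free_neq0 p_sqf; rewrite -(mlead_deg p0') /=.
  rewrite -(pd _ (mlead_supp p0')) mdegE; apply: leq_sum => i _.
  by rewrite leq_pmulr.
(* The Sylvester bound is d(2d - 1), which is at most d^2(2d - 1) as d is positive. *)
have D_size : (msize D <= (d ^ 2 * (2 * d - 1)).+1)%N.
  have [_ _ cb] := bnd.
  have cb' i : (msize (shift w c p)`_i <= d.+1)%N by apply: leq_trans (cb i) _.
  apply: leq_trans (msize_disc_bound sF cb') _.
  by rewrite ltnS; move: d_ge1; nia.
pose emb (i : 'I_(size f)) : 'I_n := cast_ord (esym (size_cat g f)) (rshift (size g) i).
have fs (i : 'I_(size f)) : f`_i = quot_proj I ((s \o emb) i).
  by rewrite /= -Ls nth_cat /= ltnNge leq_addr /= addKn.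
(* By contraposition: if no prime divides both [q] and [D], then (p, q) contains every polynomial
   vanishing on its zeros, and (P, Q) is radical. *)
have lift Q : admissible Q -> exists q r,
    [/\ Q = quot_proj I (eval_seq s q), prime_elt r, divides r q & divides r D].
  move=> [/(subalgebra_eval fs)[q' eQ] [Q_sqf _] Q_rad].
  pose q := rename_vars emb q'; have {}eQ : Q = quot_proj I (eval_seq s q).
    by rewrite eQ /q eval_seq_rename.
  have q_sqf : square_free q by apply: sqf_lift; rewrite -eQ.
  exists q; apply: contrapT => /forallNP hr; apply: Q_rad.
  have q_shift : shift w c q = q%:P.
    by apply: shift_rename => i; apply: cz; rewrite /= leq_addr.
  have nss W : (forall a, p.@[a] = 0 -> q.@[a] = 0 -> W.@[a] = 0) ->
      exists u v, W = u * p + v * q.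
    apply: (pair_nullstellensatz charK w0 bnd pc q_shift q_sqf) => r pr rq rD.
    by case: (hr r).
  have spanP x : ideal_span [:: P; Q] (quot_proj I x) <->
      exists u v, I (x - (u * eval_seq s p + v * eval_seq s q)).
    have comb u v : quot_proj I (u * eval_seq s p + v * eval_seq s q) =
        quot_proj I u * P + quot_proj I v * Q.
      by rewrite eP eQ rmorphD; congr (_ + _); apply: rmorphM.
    split=> [[k ek]|[u [v /quot_projP ->]]].
      have [u eu] := quot_proj_surj (k ord0).
      have [v ev] := quot_proj_surj (k (lift ord0 ord0)).
      exists u, v; apply/quot_projP; rewrite comb -eu -ev ek.
      by rewrite !big_ord_recl big_ord0 addr0.
    rewrite comb; apply: (ideal_add (i := ideal_span [:: P; Q]));
      apply: (ideal_mul (i := ideal_span [:: P; Q])).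
      exact: (@span_mem _ [:: P; Q] 0).
    exact: (@span_mem _ [:: P; Q] 1).
  move=> a m; have [x ->] := quot_proj_surj a.
  have -> : quot_proj I x ^+ m.+1 = quot_proj I (x ^+ m.+1) by rewrite rmorphXn.
  move=> /spanP hx; apply/spanP.
  exact: (radical_membership Icomp s_homog w0 reg prm nss hx).
have bound l (Q : 'I_l -> ideal_quotient I) : (forall i, admissible (Q i)) ->
    (forall i j, i <> j -> no_common_factor (Q i) (Q j)) ->
    (l <= d ^ 2 * (2 * d - 1))%N.
  move=> adm cop; have /choice[q /choice[r hr]] := fun i => lift _ (adm i).
  rewrite -ltnS; apply: leq_trans D_size; rewrite -[l]card_ord cardE.
  apply: (count_prime_divisors (r := r)) D0 (enum_uniq _) _ _ _ => [i _|i _|i j _ _ ij rij].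
  - by have [] := hr i.
  - by have [] := hr i.
  (* If [r i] divided [r j], its image would be a common factor of Q_i and Q_j, hence a unit,
     contradicting primality. *)
  have [eQi [_ nu _] ri _] := hr i; have [eQj _ rj _] := hr j.
  apply: nu; apply: unit_lift; apply: (cop i j ij).
    by rewrite eQi; apply: div_proj.
  by rewrite eQj; apply: div_proj; apply: divides_trans rij rj.
(* A unit Q generates the whole ring, which is radical. *)
have adm_nonunit Q : admissible Q -> ~ is_unit Q.
  move=> [_ _ Q_rad] [x ex]; apply: Q_rad => a m _.
  have -> : a = a * x * Q by rewrite -mulrA [x * Q]mulrC ex mulr1.
  by apply: (ideal_mul (i := ideal_span [:: P; Q])); apply: (@span_mem _ [:: P; Q] 1).
split=> [l Q adm cop|calH adm cop].
  split; last exact: bound adm cop.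
  (* Two equal members with distinct indices would be their own common factor, hence a unit. *)
  apply: injective_card_range => i j eij; apply: contrapT => /cop; rewrite eij => nc.
  by apply: (adm_nonunit _ (adm j)); apply: nc; apply: dividesxx.
apply: injective_card_le => m Q hQ iQ; apply: bound => [i|i j ij]; first exact: adm.
by apply: cop => // /iQ.
Qed.
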